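(* Consider the parameterized linear-quadratic optimal control problem described in the context under assumptions (A1)--(A4), with parameters $(d,d_0,d_T)$ and optimal solution $(x^*,u^*,\lambda^* )$. Let $t'\in[0,T]$, $0\ne l_{t'}\in\mathbb{R}^{n_d}$, and consider the single-point perturbation $d_p(t)=d(t)+l_{t'}\delta(t-t')$, $t\in[0,T]$, where $\delta$ is the Dirac delta. Let $(x_p^*,u_p^*,\lambda_p^* )$ be the solution corresponding to $(d_p,d_0,d_T)$ (in the sense explained in the context), and put $\delta x=x_p^*-x^*$, $\delta u=u_p^*-u^*$, $\delta\lambda=\lambda_p^*-\lambda^*$. Then there exists a constant $\Lambda(\sigma)>0$, independent of $T$, such that $$\|\delta x(t)\|+\|\delta u(t)\|+\|\delta\lambda(t)\|\le\|l_{t'}\|\cdot\Lambda(\sigma)\,e^{-\rho_Z(\sigma)|t-t'|}\qquad\text{for all }t\in[0,T],\ t\ne t',$$ where $\rho_Z(\sigma)=\gamma_Q/(2c_1(\sigma))$ and $\Lambda(\sigma)$ is given explicitly by $$\Lambda(\sigma)=\Big\{1+\frac{\lambda_H}{\gamma_R}+c_1(\sigma)\Big(1+\frac{\lambda_B}{\gamma_R}\Big)\Big\}\Lambda_x(\sigma)+c_v(\sigma)\Big(1+\frac{\lambda_B}{\gamma_R}\Big),$$ with the constants $c_1(\sigma),c_v(\sigma),\Lambda_x(\sigma)$ listed in the context.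
   Context: Norms: $\|\cdot\|$ is the Euclidean norm of vectors and the operator norm of matrices; $\|f\|_\infty=\sup_{t\in[0,T]}\|f(t)\|$. For symmetric matrices, $\preceq$ is the Loewner order. $\Phi_M(t,s)$ is the evolution operator of $\dot x(t)=M(t)x(t)$. $W_{A,B}(t_0,t_1)=\int_{t_0}^{t_1}\Phi_A(t_0,s)B(s)B^\top(s)\Phi_A^\top(t_0,s)\,ds$. Parameterized problem: given $d:[0,T]\to\mathbb{R}^{n_d}$ (bounded and measurable), $d_0\in\mathbb{R}^{n_x}$, $d_T\in\mathbb{R}^{n_d}$, minimize over $(u,x)$ $$\frac12\int_0^T\begin{bmatrix}x\\ u\\ d\end{bmatrix}^\top\begin{bmatrix}Q&H^\top&G^\top\\ H&R&W^\top\\ G&W&0\end{bmatrix}\begin{bmatrix}x\\ u\\ d\end{bmatrix}dt+\frac12\begin{bmatrix}x(T)\\ d_T\end{bmatrix}^\top\begin{bmatrix}Q_T&G_T^\top\\ G_T&0\end{bmatrix}\begin{bmatrix}x(T)\\ d_T\end{bmatrix}$$ subject to $\dot x(t)=A(t)x(t)+B(t)u(t)+C(t)d(t)$ on $(0,T]$, $x(0)=d_0$. Here $A(t)\in\mathbb{R}^{n_x\times n_x}$, $B(t)\in\mathbb{R}^{n_x\times n_u}$, $H(t)\in\mathbb{R}^{n_u\times n_x}$, $G(t)\in\mathbb{R}^{n_d\times n_x}$, $W(t)\in\mathbb{R}^{n_d\times n_u}$, $C(t)\in\mathbb{R}^{n_x\times n_d}$, $G_T\in\mathbb{R}^{n_d\times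 n_x}$, and $Q(t),R(t),Q_T$ are symmetric. The adjoint of the optimal pair solves $\dot\lambda^*=-A^\top\lambda^*-Qx^*-H^\top u^*-G^\top d$, $\lambda^*(T)=Q_Tx^*(T)+G_T^\top d_T$. Assumptions. (A1) $A,B,Q,H,R$ are continuous on $[0,T]$ with $\|A\|_\infty\le\lambda_A$, $\|B\|_\infty\le\lambda_B$, $\|Q\|_\infty\le\lambda_Q$, $\|H\|_\infty\le\lambda_H$, $\|R\|_\infty\le\lambda_R$, for positive constants independent of $T$. (A2) (Uniform complete controllability) There are $\sigma\in(0,T)$ and constants $\alpha_0,\alpha_1,\beta_0,\beta_1>0$ (possibly depending on $\sigma$) such that for every $t_0\in[0,T-\sigma]$ there is $t_1\in[t_0,t_0+\sigma]$ with $\alpha_0I\preceq W_{A,B}(t_0,t_1)\preceq\alpha_1I$ and $\beta_0I\preceq\Phi_A(t_1,t_0)W_{A,B}(t_0,t_1)\Phi_A^\top(t_1,t_0)\preceq\beta_1I$. (A3) There are $\gamma_R,\gamma_Q>0$ independent of $T$ with $R(t)\succeq\gamma_RI$ and $Q(t)-H^\top(t)R^{-1}(t)H(t)\succeq\gamma_QI$ for all $t\in[0,T]$, and $\gamma_QI\preceq Q_T\preceq\lambda_QI$. (A4) $G,W,C$ are continuous with $\|G\|_\infty\le\lambda_G$, $\|W\|_\infty\le\lambda_W$, $\|C\|_\infty\le\lambda_C$ for positive constants independent of $T$, and $\|G_T\|\le\lambda_G$. Meaning of the perturbed solution. Let $S$ be the solution on $[0,T]$ of the Riccati equation $\dot S=SBR^{-1}B^\top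 S-S(A-BR^{-1}H)-(A-BR^{-1}H)^\top S-(Q-H^\top R^{-1}H)$, $S(T)=Q_T$; $Z=A-BR^{-1}H-BR^{-1}B^\top S$; $Y=WR^{-1}(B^\top S+H)-(G+C^\top S)$. For a parameter $d$ the optimal solution is given by $v(t)=\Phi_Z(T,t)^\top G_T^\top d_T-\int_t^T\Phi_Z(s,t)^\top Y(s)^\top d(s)\,ds$, $x^*(t)=\Phi_Z(t,0)d_0+\int_0^t\Phi_Z(t,s)\{-B(s)R^{-1}(s)B^\top(s)v(s)+(C(s)-B(s)R^{-1}(s)W^\top(s))d(s)\}\,ds$, $\lambda^*=Sx^*+v$, $u^*=-R^{-1}(Hx^*+B^\top\lambda^*+W^\top d)$. The perturbed solution $(x_p^*,u_p^*,\lambda_p^* )$ is defined by the same formulas with $d$ replaced by $d_p$, with the convention that $\int_{t_a}^{t_b}f(s)\delta(s-t')\,ds=f(t')$ if $t'\in[t_a,t_b]$ and $=0$ otherwise, and $d_p(t)=d(t)$ pointwise for $t\ne t'$. Constants: $\kappa=\lambda_A+\lambda_B\lambda_H/\gamma_R$; $\alpha_1'=\frac{\lambda_B^2(e^{2\kappa\sigma}-1)}{2\kappa}$; $\alpha_0'=\Big(\frac{2}{\alpha_0}+\frac{\lambda_H^2}{\gamma_R^2\lambda_A}\big(1+\frac{\alpha_1}{\alpha_0}\big)^2(e^{2\lambda_A\sigma}-1)\Big)^{-1}$; $\tilde\alpha_0=\frac{1-e^{-2\kappa\sigma}}{2\kappa}$; $\tilde\alpha_1=\frac{e^{2\kappa\sigma}-1}{2\kappa}$;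 $c_0(\sigma)=\min\Big\{2\kappa\Big(\frac{\lambda_B^2}{\gamma_R}\big(1+\frac{\tilde\alpha_1}{\tilde\alpha_0}\big)^2+\frac{1}{\gamma_Q\tilde\alpha_0^2}\Big)^{-1},\Big(\frac{\lambda_B^2}{2\gamma_R\kappa}+\frac1{\gamma_Q}\Big)^{-1}\Big\}e^{-2\kappa\sigma}$; $c_1(\sigma)=\max\Big\{\frac{1}{2\kappa}\Big(\big(\lambda_Q+\frac{\lambda_H^2}{\gamma_R}\big)\big(1+\frac{\alpha_1'}{\alpha_0'}\big)^2+\frac{\lambda_R\lambda_B^2}{(\alpha_0')^2}\Big),\big(\lambda_Q+\frac{\lambda_H^2}{\gamma_R}\big)\big(1+\frac1{2\kappa}\big)\Big\}e^{2\kappa\sigma}$; $c_Z(\sigma)=\sqrt{c_1(\sigma)/c_0(\sigma)}$; $\rho_Z(\sigma)=\gamma_Q/(2c_1(\sigma))$; $c_v(\sigma)=c_Z(\sigma)\Big\{\big(\frac{\lambda_W\lambda_B}{\gamma_R}+\lambda_C\big)c_1(\sigma)+\frac{\lambda_W\lambda_H}{\gamma_R}+\lambda_G\Big\}$; $\Lambda_x(\sigma)=c_Z(\sigma)\Big\{\frac{c_v(\sigma)\lambda_B^2}{2\rho_Z(\sigma)\gamma_R}+\frac{\lambda_W\lambda_B}{\gamma_R}+\lambda_C\Big\}$. *)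

(* Defs.v *)
From mathcomp Require Export all_boot all_order all_algebra.
From mathcomp Require Export all_classical all_reals all_analysis.

Set Implicit Arguments.
Unset Strict Implicit.
Unset Printing Implicit Defensive.

Import Order.TTheory GRing.Theory Num.Theory.
Import numFieldNormedType.Exports.

Local Open Scope classical_set_scope.
Local Open Scope ring_scope.

(* The library norm on matrices is the entrywise maximum; the Euclidean and
   operator norms are therefore defined here.  The topologies coincide, so the
   library's continuity and derivatives of matrix-valued maps are used as is. *)
Definition enorm (R : realType) (n : nat) (x : 'cV[R]_n) : R :=
  Num.sqrt (\sum_i x i 0 ^+ 2).

Definition opnorm (R : realType) (m n : nat) (M : 'M[R]_(m, n)) : R :=
  sup [set enorm (M *m x) | x in [set x : 'cV[R]_n | enorm x <= 1]].

(* Taken in the extended reals, so that an unbounded map has norm +oo. *)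
Definition supnorm (R : realType) (m n : nat) (T : R) (F : R -> 'M[R]_(m, n)) :
    \bar R :=
  ereal_sup [set (opnorm (F t))%:E | t in `[0, T]].

Definition quadform (R : realType) (n : nat) (M : 'M[R]_n) (x : 'cV[R]_n) : R :=
  (x^T *m M *m x) 0 0.

(* Only ever applied to symmetric matrices. *)
Definition loewner_le (R : realType) (n : nat) (M N : 'M[R]_n) : Prop :=
  forall x : 'cV[R]_n, 0 <= quadform (N - M) x.

(* Entrywise Lebesgue integral over [a, b]. *)
Definition mxint (R : realType) (m n : nat) (a b : R) (F : R -> 'M[R]_(m, n)) :
    'M[R]_(m, n) :=
  \matrix_(i, j) \int[lebesgue_measure]_(s in `[a, b]) F s i j.

(* Integral over [a, b] of f(s) + g(s) delta(s - t'), delta being the Dirac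
   delta: the atom contributes g(t') as soon as t' lies in the closed interval,
   endpoints included. *)
Definition mxint_dirac (R : realType) (m n : nat) (a b t' : R)
    (f g : R -> 'M[R]_(m, n)) : 'M[R]_(m, n) :=
  mxint a b f + (if a <= t' <= b then g t' else 0).

(* X is a classical solution of X' = F on [0, T]; for F continuous on [0, T],
   the one-sided derivatives at 0 and T then exist and satisfy the equation. *)
Definition solves_ode (R : realType) (m n : nat) (T : R)
    (X F : R -> 'M[R]_(m, n)) : Prop :=
  {within `[0, T], continuous X} /\
  (forall t, t \in `]0, T[ -> is_derive t (1 : R) X (F t)).

(* X is a Caratheodory solution of X' = F on [0, T]: F is integrable and X is an
   indefinite integral of F.  This is the meaning of the state and adjoint
   equations, whose right-hand sides are merely measurable in time. *)
Definition solves_ode_ae (R : realType) (m n : nat) (T : R)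
    (X F : R -> 'M[R]_(m, n)) : Prop :=
  (forall i j, lebesgue_measure.-integrable `[0, T] (fun t => (F t i j)%:E)) /\
  (forall t, t \in `[0, T] -> X t = X 0 + mxint 0 t F).

(* Phi t s is the evolution operator of x' = M x between arbitrary times s and t
   of [0, T], in either order. *)
Definition is_evolution (R : realType) (n : nat) (T : R) (M : R -> 'M[R]_n)
    (Phi : R -> R -> 'M[R]_n) : Prop :=
  forall s, s \in `[0, T] ->
    Phi s s = 1%:M /\
    solves_ode T (fun t => Phi t s) (fun t => M t *m Phi t s).

Definition gramian (R : realType) (n m : nat) (Phi : R -> R -> 'M[R]_n)
    (B : R -> 'M[R]_(n, m)) (t0 t1 : R) : 'M[R]_n :=
  mxint t0 t1 (fun s => Phi t0 s *m B s *m (B s)^T *m (Phi t0 s)^T).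

Record lq_data (R : realType) (nx nu nd : nat) := LQData {
  fA : R -> 'M[R]_nx;
  fB : R -> 'M[R]_(nx, nu);
  fC : R -> 'M[R]_(nx, nd);
  fQ : R -> 'M[R]_nx;
  fH : R -> 'M[R]_(nu, nx);
  fR : R -> 'M[R]_nu;
  fG : R -> 'M[R]_(nd, nx);
  fW : R -> 'M[R]_(nd, nu);
  mQT : 'M[R]_nx;
  mGT : 'M[R]_(nd, nx)
}.

Record lq_consts (R : realType) := LQConsts {
  sigma : R;
  lamA : R; lamB : R; lamC : R; lamQ : R; lamH : R; lamR : R; lamG : R; lamW : R;
  gamR : R; gamQ : R;
  alpha0 : R; alpha1 : R; beta0 : R; beta1 : R
}.

Definition consts_pos (R : realType) (k : lq_consts R) : Prop :=
  0 < sigma k /\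
  [/\ 0 < lamA k, 0 < lamB k, 0 < lamC k & 0 < lamQ k] /\
  [/\ 0 < lamH k, 0 < lamR k, 0 < lamG k & 0 < lamW k] /\
  0 < gamR k /\ 0 < gamQ k /\
  [/\ 0 < alpha0 k, 0 < alpha1 k, 0 < beta0 k & 0 < beta1 k].

Definition lq_symmetric (R : realType) (nx nu nd : nat) (T : R)
    (p : lq_data R nx nu nd) : Prop :=
  (forall t, t \in `[0, T] -> (fQ p t)^T = fQ p t /\ (fR p t)^T = fR p t) /\
  (mQT p)^T = mQT p.

Definition assumption_A1 (R : realType) (nx nu nd : nat) (T : R)
    (p : lq_data R nx nu nd) (k : lq_consts R) : Prop :=
  [/\ {within `[0, T], continuous (fA p)}, {within `[0, T], continuous (fB p)},
      {within `[0, T], continuous (fQ p)}, {within `[0, T], continuous (fH p)}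
    & {within `[0, T], continuous (fR p)}] /\
  [/\ (supnorm T (fA p) <= (lamA k)%:E)%E, (supnorm T (fB p) <= (lamB k)%:E)%E,
      (supnorm T (fQ p) <= (lamQ k)%:E)%E, (supnorm T (fH p) <= (lamH k)%:E)%E
    & (supnorm T (fR p) <= (lamR k)%:E)%E].

(* PhiA stands for the evolution operator of x' = A x. *)
Definition assumption_A2 (R : realType) (nx nu nd : nat) (T : R)
    (p : lq_data R nx nu nd) (k : lq_consts R) (PhiA : R -> R -> 'M[R]_nx) :
    Prop :=
  sigma k < T /\
  forall t0, 0 <= t0 <= T - sigma k ->
  exists t1, [/\ t0 <= t1 <= t0 + sigma k,
    loewner_le (alpha0 k)%:M (gramian PhiA (fB p) t0 t1),
    loewner_le (gramian PhiA (fB p) t0 t1) (alpha1 k)%:M,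
    loewner_le (beta0 k)%:M
      (PhiA t1 t0 *m gramian PhiA (fB p) t0 t1 *m (PhiA t1 t0)^T)
  & loewner_le (PhiA t1 t0 *m gramian PhiA (fB p) t0 t1 *m (PhiA t1 t0)^T)
      (beta1 k)%:M].

Definition assumption_A3 (R : realType) (nx nu nd : nat) (T : R)
    (p : lq_data R nx nu nd) (k : lq_consts R) : Prop :=
  [/\ forall t, t \in `[0, T] -> loewner_le (gamR k)%:M (fR p t),
      forall t, t \in `[0, T] -> loewner_le (gamQ k)%:M
        (fQ p t - (fH p t)^T *m invmx (fR p t) *m fH p t),
      loewner_le (gamQ k)%:M (mQT p)
    & loewner_le (mQT p) (lamQ k)%:M].

Definition assumption_A4 (R : realType) (nx nu nd : nat) (T : R)
    (p : lq_data R nx nu nd) (k : lq_consts R) : Prop :=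
  [/\ {within `[0, T], continuous (fG p)}, {within `[0, T], continuous (fW p)}
    & {within `[0, T], continuous (fC p)}] /\
  [/\ (supnorm T (fG p) <= (lamG k)%:E)%E, (supnorm T (fW p) <= (lamW k)%:E)%E,
      (supnorm T (fC p) <= (lamC k)%:E)%E & opnorm (mGT p) <= lamG k].

Definition bounded_measurable (R : realType) (n : nat) (T : R)
    (d : R -> 'cV[R]_n) : Prop :=
  (forall i, measurable_fun `[0, T] (fun t => d t i 0)) /\
  (exists c : R, forall t, t \in `[0, T] -> enorm (d t) <= c).

Definition lq_cost (R : realType) (nx nu nd : nat) (T : R)
    (p : lq_data R nx nu nd) (d : R -> 'cV[R]_nd) (dT : 'cV[R]_nd)
    (x : R -> 'cV[R]_nx) (u : R -> 'cV[R]_nu) : R :=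
  2^-1 * (\int[lebesgue_measure]_(t in `[0, T])
    quadform
      (block_mx (block_mx (fQ p t) (fH p t)^T (fH p t) (fR p t))
                (col_mx (fG p t)^T (fW p t)^T)
                (row_mx (fG p t) (fW p t)) 0)
      (col_mx (col_mx (x t) (u t)) (d t)))
  + 2^-1 * quadform (block_mx (mQT p) (mGT p)^T (mGT p) 0) (col_mx (x T) dT).

(* Controls are square-integrable on [0, T]. *)
Definition lq_admissible (R : realType) (nx nu nd : nat) (T : R)
    (p : lq_data R nx nu nd) (d : R -> 'cV[R]_nd) (d0 : 'cV[R]_nx)
    (x : R -> 'cV[R]_nx) (u : R -> 'cV[R]_nu) : Prop :=
  [/\ forall i, measurable_fun `[0, T] (fun t => u t i 0),
      lebesgue_measure.-integrable `[0, T] (fun t => (enorm (u t) ^+ 2)%:E),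
      solves_ode_ae T x
        (fun t => fA p t *m x t + fB p t *m u t + fC p t *m d t)
    & x 0 = d0].

Definition lq_minimizer (R : realType) (nx nu nd : nat) (T : R)
    (p : lq_data R nx nu nd) (d : R -> 'cV[R]_nd) (d0 : 'cV[R]_nx)
    (dT : 'cV[R]_nd) (x : R -> 'cV[R]_nx) (u : R -> 'cV[R]_nu) : Prop :=
  lq_admissible T p d d0 x u /\
  forall x1 u1, lq_admissible T p d d0 x1 u1 ->
    lq_cost T p d dT x u <= lq_cost T p d dT x1 u1.

Definition lq_adjoint (R : realType) (nx nu nd : nat) (T : R)
    (p : lq_data R nx nu nd) (d : R -> 'cV[R]_nd) (dT : 'cV[R]_nd)
    (x : R -> 'cV[R]_nx) (u : R -> 'cV[R]_nu) (lam : R -> 'cV[R]_nx) : Prop :=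
  solves_ode_ae T lam
    (fun t => - ((fA p t)^T *m lam t) - fQ p t *m x t - (fH p t)^T *m u t
              - (fG p t)^T *m d t) /\
  lam T = mQT p *m x T + (mGT p)^T *m dT.

(* u = - R^-1 (H x + B^T lam + W^T d), pointwise. *)
Definition control_law (R : realType) (nx nu nd : nat) (p : lq_data R nx nu nd)
    (d : R -> 'cV[R]_nd) (x lam : R -> 'cV[R]_nx) (t : R) : 'cV[R]_nu :=
  - (invmx (fR p t) *m
     (fH p t *m x t + (fB p t)^T *m lam t + (fW p t)^T *m d t)).

(* A minimizing control is unique only almost everywhere; the last clause selects
   its representative satisfying the stationarity condition at every time. *)
Definition lq_optimal (R : realType) (nx nu nd : nat) (T : R)
    (p : lq_data R nx nu nd) (d : R -> 'cV[R]_nd) (d0 : 'cV[R]_nx)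
    (dT : 'cV[R]_nd) (x : R -> 'cV[R]_nx) (u : R -> 'cV[R]_nu)
    (lam : R -> 'cV[R]_nx) : Prop :=
  [/\ lq_minimizer T p d d0 dT x u,
      lq_adjoint T p d dT x u lam
    & forall t, t \in `[0, T] -> u t = control_law p d x lam t].

Definition riccati_solution (R : realType) (nx nu nd : nat) (T : R)
    (p : lq_data R nx nu nd) (S : R -> 'M[R]_nx) : Prop :=
  solves_ode T S (fun t =>
    S t *m fB p t *m invmx (fR p t) *m (fB p t)^T *m S t
    - S t *m (fA p t - fB p t *m invmx (fR p t) *m fH p t)
    - (fA p t - fB p t *m invmx (fR p t) *m fH p t)^T *m S t
    - (fQ p t - (fH p t)^T *m invmx (fR p t) *m fH p t)) /\
  S T = mQT p.

Definition Zmat (R : realType) (nx nu nd : nat) (p : lq_data R nx nu nd)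
    (S : R -> 'M[R]_nx) (t : R) : 'M[R]_nx :=
  fA p t - fB p t *m invmx (fR p t) *m fH p t
  - fB p t *m invmx (fR p t) *m (fB p t)^T *m S t.

Definition Ymat (R : realType) (nx nu nd : nat) (p : lq_data R nx nu nd)
    (S : R -> 'M[R]_nx) (t : R) : 'M[R]_(nd, nx) :=
  fW p t *m invmx (fR p t) *m ((fB p t)^T *m S t + fH p t)
  - (fG p t + (fC p t)^T *m S t).

(* The solution associated with the parameter d + l delta(. - t'): the optimal
   solution formulas, with integrals against the parameter read through
   mxint_dirac.  Phi stands for the evolution operator of Z. *)
Definition v_pert (R : realType) (nx nu nd : nat) (T : R)
    (p : lq_data R nx nu nd) (S : R -> 'M[R]_nx) (Phi : R -> R -> 'M[R]_nx)
    (d : R -> 'cV[R]_nd) (dT : 'cV[R]_nd) (t' : R) (l : 'cV[R]_nd) (t : R) :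
    'cV[R]_nx :=
  (Phi T t)^T *m (mGT p)^T *m dT
  - mxint_dirac t T t'
      (fun s => (Phi s t)^T *m (Ymat p S s)^T *m d s)
      (fun s => (Phi s t)^T *m (Ymat p S s)^T *m l).

Definition x_pert (R : realType) (nx nu nd : nat) (T : R)
    (p : lq_data R nx nu nd) (S : R -> 'M[R]_nx) (Phi : R -> R -> 'M[R]_nx)
    (d : R -> 'cV[R]_nd) (d0 : 'cV[R]_nx) (dT : 'cV[R]_nd) (t' : R)
    (l : 'cV[R]_nd) (t : R) : 'cV[R]_nx :=
  Phi t 0 *m d0
  + mxint_dirac 0 t t'
      (fun s => Phi t s *m
        (- (fB p s *m invmx (fR p s) *m (fB p s)^T
              *m v_pert T p S Phi d dT t' l s)
         + (fC p s - fB p s *m invmx (fR p s) *m (fW p s)^T) *m d s))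
      (fun s => Phi t s *m
        ((fC p s - fB p s *m invmx (fR p s) *m (fW p s)^T) *m l)).

Definition lam_pert (R : realType) (nx nu nd : nat) (T : R)
    (p : lq_data R nx nu nd) (S : R -> 'M[R]_nx) (Phi : R -> R -> 'M[R]_nx)
    (d : R -> 'cV[R]_nd) (d0 : 'cV[R]_nx) (dT : 'cV[R]_nd) (t' : R)
    (l : 'cV[R]_nd) (t : R) : 'cV[R]_nx :=
  S t *m x_pert T p S Phi d d0 dT t' l t + v_pert T p S Phi d dT t' l t.

(* Meaningful for t <> t' only, where the perturbed parameter takes the value
   d t; at t' the control carries a Dirac atom. *)
Definition u_pert (R : realType) (nx nu nd : nat) (T : R)
    (p : lq_data R nx nu nd) (S : R -> 'M[R]_nx) (Phi : R -> R -> 'M[R]_nx)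
    (d : R -> 'cV[R]_nd) (d0 : 'cV[R]_nx) (dT : 'cV[R]_nd) (t' : R)
    (l : 'cV[R]_nd) (t : R) : 'cV[R]_nu :=
  control_law p d (x_pert T p S Phi d d0 dT t' l)
    (lam_pert T p S Phi d d0 dT t' l) t.

Definition kappa (R : realType) (k : lq_consts R) : R :=
  lamA k + lamB k * lamH k / gamR k.

Definition alpha1' (R : realType) (k : lq_consts R) : R :=
  lamB k ^+ 2 * (expR (2 * kappa k * sigma k) - 1) / (2 * kappa k).

Definition alpha0' (R : realType) (k : lq_consts R) : R :=
  (2 / alpha0 k
   + lamH k ^+ 2 / (gamR k ^+ 2 * lamA k) * (1 + alpha1 k / alpha0 k) ^+ 2
     * (expR (2 * lamA k * sigma k) - 1))^-1.

Definition talpha0 (R : realType) (k : lq_consts R) : R :=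
  (1 - expR (- (2 * kappa k * sigma k))) / (2 * kappa k).

Definition talpha1 (R : realType) (k : lq_consts R) : R :=
  (expR (2 * kappa k * sigma k) - 1) / (2 * kappa k).

Definition c0 (R : realType) (k : lq_consts R) : R :=
  Num.min
    (2 * kappa k *
     (lamB k ^+ 2 / gamR k * (1 + talpha1 k / talpha0 k) ^+ 2
      + 1 / (gamQ k * talpha0 k ^+ 2))^-1)
    (lamB k ^+ 2 / (2 * gamR k * kappa k) + 1 / gamQ k)^-1
  * expR (- (2 * kappa k * sigma k)).

Definition c1 (R : realType) (k : lq_consts R) : R :=
  Num.max
    (1 / (2 * kappa k) *
     ((lamQ k + lamH k ^+ 2 / gamR k) * (1 + alpha1' k / alpha0' k) ^+ 2
      + lamR k * lamB k ^+ 2 / alpha0' k ^+ 2))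
    ((lamQ k + lamH k ^+ 2 / gamR k) * (1 + 1 / (2 * kappa k)))
  * expR (2 * kappa k * sigma k).

Definition cZ (R : realType) (k : lq_consts R) : R := Num.sqrt (c1 k / c0 k).

Definition rhoZ (R : realType) (k : lq_consts R) : R := gamQ k / (2 * c1 k).

Definition cv (R : realType) (k : lq_consts R) : R :=
  cZ k * ((lamW k * lamB k / gamR k + lamC k) * c1 k
          + lamW k * lamH k / gamR k + lamG k).

Definition Lambda_x (R : realType) (k : lq_consts R) : R :=
  cZ k * (cv k * lamB k ^+ 2 / (2 * rhoZ k * gamR k)
          + lamW k * lamB k / gamR k + lamC k).

Definition Lambda (R : realType) (k : lq_consts R) : R :=
  (1 + lamH k / gamR k + c1 k * (1 + lamB k / gamR k)) * Lambda_x k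
  + cv k * (1 + lamB k / gamR k).

(* Main.v *)
(* Proof idea.  Everything reduces to two-sided bounds [c0 <= S(t) <= c1] and to the decay
   of the evolution operator of [Z].  The lower bound needs no duality: the constant
   [c0] satisfies [2 kappa c0 + (lamB^2 / gamR) c0^2 <= gamQ] and [c0 <= gamQ], so
   [x^T S x - c0 |x|^2] decreases along the closed loop [x' = Z x] and is nonnegative at
   [T].  For the upper bound, [x0^T S(t0) x0] is at most the cost of any trajectory from
   [x0]: steer [x0] to 0 with the Gramian control of the pair (A, B), or use [u = 0] when
   less than [sigma] is left.  Then [x^T S x] is a Lyapunov function of the closed loop,
   which yields the constants [cZ] and [rhoZ].  Integration by parts against the evolution
   operator of [Z] shows that the optimal solution is given by the formulas with no
   perturbation, so the differences consist of the Dirac terms and of one integral of a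
   product of two decaying exponentials. *)
Require Import Defs.
From mathcomp Require Import measurable_realfun ring lra.

Set Implicit Arguments.
Unset Strict Implicit.
Unset Printing Implicit Defensive.

Import Order.TTheory GRing.Theory Num.Theory.
Import numFieldNormedType.Exports.

Local Open Scope classical_set_scope.
Local Open Scope ring_scope.

(** * Euclidean geometry *)

Section Euclid.
Variable R : realType.

(** Two kinds of functions meet here. [S], the evolution operators and the comparison trajectories
    are classical: continuous on the closed interval, differentiable inside. The optimal [x] and
    [lam] are driven by a merely measurable [d], hence only absolutely continuous, and no pointwise
    product rule applies to them. Integration by parts between the two kinds is therefore proved by
    hand and always puts the classical factor on one side. All comparisons of costs are monotonicity
    statements: [x^T S x] plus a primitive of a bound on the running cost is nondecreasing along a
    trajectory. The Gramian and the state formula involve evolution operators as functions of their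
    second argument, where the definition prescribes no derivative; it is obtained by
    differentiating an inverse matrix. Steering uses [A] itself, while the cost is measured in
    [u + R^-1 H x]. Splitting the square of that sum explains [alpha0']: its inverse adds twice the
    energy bound [1 / alpha0] to the contribution of [R^-1 H x]. *)

Definition dot (n : nat) (x y : 'cV[R]_n) : R := (x^T *m y) 0 0.

Lemma dotE n (x y : 'cV[R]_n) : dot x y = \sum_i x i 0 * y i 0.
Proof. by rewrite /dot mxE; apply: eq_bigr => i _; rewrite mxE. Qed.

Lemma dotC n (x y : 'cV[R]_n) : dot x y = dot y x.
Proof. by rewrite !dotE; apply: eq_bigr => i _; rewrite mulrC. Qed.

Lemma dotDr n (x y z : 'cV[R]_n) : dot x (y + z) = dot x y + dot x z.
Proof. by rewrite /dot mulmxDr mxE. Qed.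

Lemma dotNr n (x y : 'cV[R]_n) : dot x (- y) = - dot x y.
Proof. by rewrite /dot mulmxN mxE. Qed.

Lemma dotZr n (x y : 'cV[R]_n) a : dot x (a *: y) = a * dot x y.
Proof. by rewrite /dot -scalemxAr mxE. Qed.

Lemma dotDl n (x y z : 'cV[R]_n) : dot (y + z) x = dot y x + dot z x.
Proof. by rewrite dotC dotDr !(dotC x). Qed.

Lemma dotNl n (x y : 'cV[R]_n) : dot (- y) x = - dot y x.
Proof. by rewrite dotC dotNr dotC. Qed.

Lemma dotZl n (x y : 'cV[R]_n) a : dot (a *: y) x = a * dot y x.
Proof. by rewrite dotC dotZr dotC. Qed.

Lemma dot_mull m n (A : 'M[R]_(m, n)) x y : dot (A *m x) y = dot x (A^T *m y).
Proof. by rewrite /dot trmx_mul mulmxA. Qed.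

Lemma dot_mulr m n (A : 'M[R]_(m, n)) x y : dot y (A *m x) = dot (A^T *m y) x.
Proof. by rewrite dot_mull trmxK. Qed.

Lemma quadformE n (M : 'M[R]_n) x : quadform M x = dot x (M *m x).
Proof. by rewrite /quadform /dot mulmxA. Qed.

Lemma enorm_ge0 n (x : 'cV[R]_n) : 0 <= enorm x.
Proof. exact: sqrtr_ge0. Qed.

Lemma enorm_sqr n (x : 'cV[R]_n) : enorm x ^+ 2 = dot x x.
Proof.
rewrite /enorm sqr_sqrtr; last by apply: sumr_ge0 => i _; exact: sqr_ge0.
by rewrite dotE; apply: eq_bigr => i _; rewrite expr2.
Qed.

Lemma dotxx_ge0 n (x : 'cV[R]_n) : 0 <= dot x x.
Proof. by rewrite -enorm_sqr sqr_ge0. Qed.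

Lemma enorm0 n : enorm (0 : 'cV[R]_n) = 0.
Proof. by rewrite /enorm big1 ?sqrtr0// => i _; rewrite mxE expr0n. Qed.

Lemma enorm_eq0 n (x : 'cV[R]_n) : enorm x = 0 -> x = 0.
Proof.
move=> x0; have : dot x x = 0 by rewrite -enorm_sqr x0 expr0n.
rewrite dotE => /eqP; rewrite psumr_eq0; last by move=> i _; rewrite -expr2 sqr_ge0.
move/allP => h; apply/colP => i; rewrite mxE.
by have := h i (mem_index_enum i); rewrite /= -expr2 sqrf_eq0 => /eqP.
Qed.

Lemma enorm_gt0 n (x : 'cV[R]_n) : x != 0 -> 0 < enorm x.
Proof.
move=> x0; rewrite lt_neqAle enorm_ge0 andbT eq_sym.
by apply: contra x0 => /eqP/enorm_eq0 ->.
Qed.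

Lemma enormN n (x : 'cV[R]_n) : enorm (- x) = enorm x.
Proof. by rewrite /enorm; congr Num.sqrt; apply: eq_bigr => i _; rewrite mxE sqrrN. Qed.

Lemma enormZ n (x : 'cV[R]_n) a : enorm (a *: x) = `|a| * enorm x.
Proof.
apply/eqP; rewrite -(@eqrXn2 _ 2)// ?enorm_ge0 ?mulr_ge0 ?enorm_ge0//.
by rewrite exprMn !enorm_sqr dotZl dotZr mulrA -expr2 real_normK ?num_real.
Qed.

Lemma cauchy_schwarz n (x y : 'cV[R]_n) : dot x y <= enorm x * enorm y.
Proof.
have [->|/enorm_gt0 x0] := eqVneq x 0.
  by rewrite enorm0 mul0r dotE big1 // => i _; rewrite mxE mul0r.
have [->|/enorm_gt0 y0] := eqVneq y 0.
  by rewrite enorm0 mulr0 dotE big1 // => i _; rewrite mxE mulr0.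
have := dotxx_ge0 (enorm x *: y - enorm y *: x).
rewrite dotDl !dotDr !dotNl !dotNr !dotZl !dotZr -!enorm_sqr (dotC y x).
have -> (a b c : R) : a * (a * b ^+ 2) - a * (b * c) + (- (b * (a * c)) - - (b * (b * a ^+ 2)))
   = 2 * (a * b) * (a * b - c) by ring.
by rewrite pmulr_rge0 ?subr_ge0// !mulr_gt0.
Qed.

Lemma enormD n (x y : 'cV[R]_n) : enorm (x + y) <= enorm x + enorm y.
Proof.
rewrite -(@ler_pXn2r _ 2)// ?nnegrE ?addr_ge0 ?enorm_ge0//.
rewrite enorm_sqr dotDl !dotDr sqrrD -!enorm_sqr (dotC y x).
have := cauchy_schwarz x y; lra.
Qed.

Lemma normr_entry_le n (x : 'cV[R]_n) i : `|x i 0| <= enorm x.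
Proof.
rewrite -(@ler_pXn2r _ 2)// ?nnegrE ?enorm_ge0// enorm_sqr dotE (bigD1 i)//=.
rewrite real_normK ?num_real// expr2 lerDl.
by apply: sumr_ge0 => j _; rewrite -expr2 sqr_ge0.
Qed.

(** Duality reduces norm estimates of transposes, symmetric forms and integrals to estimates of
    scalars; testing at [y = x] is enough. *)
Lemma enorm_le_dot n (x : 'cV[R]_n) c : 0 <= c ->
  (forall y, dot y x <= enorm y * c) -> enorm x <= c.
Proof.
move=> c0 /(_ x); rewrite -enorm_sqr expr2.
have := enorm_ge0 x; rewrite le_eqVlt => /predU1P[<-//|x0].
by rewrite ler_pM2l.
Qed.

(** An upper bound for the operator norm expressed on vectors, so that products, sums and transposes
    are estimated without handling the supremum in [opnorm]. *)
Definition opbound m n (A : 'M[R]_(m, n)) (c : R) :=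
  forall x, enorm (A *m x) <= c * enorm x.

Lemma opbound_mul m n p (A : 'M[R]_(m, n)) (B : 'M[R]_(n, p)) a b :
  0 <= a -> opbound A a -> opbound B b -> opbound (A *m B) (a * b).
Proof.
move=> a0 hA hB x; rewrite -mulmxA (le_trans (hA _))// -mulrA ler_wpM2l//.
Qed.

Lemma opboundD m n (A B : 'M[R]_(m, n)) a b :
  opbound A a -> opbound B b -> opbound (A + B) (a + b).
Proof.
by move=> hA hB x; rewrite mulmxDl (le_trans (enormD _ _))// mulrDl lerD.
Qed.

Lemma opboundN m n (A : 'M[R]_(m, n)) a : opbound A a -> opbound (- A) a.
Proof. by move=> hA x; rewrite mulNmx enormN. Qed.

Lemma opboundB m n (A B : 'M[R]_(m, n)) a b :
  opbound A a -> opbound B b -> opbound (A - B) (a + b).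
Proof. by move=> hA hB; apply: opboundD => //; apply: opboundN. Qed.

Lemma opbound_tr m n (A : 'M[R]_(m, n)) c : 0 <= c -> opbound A c -> opbound A^T c.
Proof.
move=> c0 h x; apply: enorm_le_dot => [|y]; first by rewrite mulr_ge0 ?enorm_ge0.
rewrite -dot_mull (le_trans (cauchy_schwarz _ _))// mulrCA mulrA ler_wpM2r ?enorm_ge0//.
Qed.

Lemma enorm_le_sum n (x : 'cV[R]_n) : enorm x <= \sum_i `|x i 0|.
Proof.
rewrite -(@ler_pXn2r _ 2)// ?nnegrE ?enorm_ge0 ?sumr_ge0//.
rewrite enorm_sqr dotE expr2 mulr_suml; apply: ler_sum => i _.
rewrite -expr2 -real_normK ?num_real// expr2 ler_wpM2l//.
by rewrite (bigD1 i)//= lerDl sumr_ge0.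
Qed.

Lemma opnorm_has_sup m n (A : 'M[R]_(m, n)) :
  has_sup [set enorm (A *m x) | x in [set x : 'cV[R]_n | enorm x <= 1]].
Proof.
split; first by exists (enorm (A *m 0)), 0 => //=; rewrite enorm0.
(* [sup] on the reals is meaningful only for bounded sets; the sum of all entries in absolute value
   is a bound on the unit ball. *)
exists (\sum_i \sum_j `|A i j|) => _ [x /= x1 <-].
apply: (le_trans (enorm_le_sum _)); apply: ler_sum => i _.
rewrite mxE (le_trans (ler_norm_sum _ _ _))//; apply: ler_sum => j _.
rewrite normrM ler_piMr// (le_trans (normr_entry_le _ _))//.
Qed.

Lemma opbound_opnorm m n (A : 'M[R]_(m, n)) : opbound A (opnorm A).
Proof.
move=> x; have [->|x0] := eqVneq x 0; first by rewrite mulmx0 !enorm0 mulr0.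
have xp := enorm_gt0 x0.
have : enorm (A *m ((enorm x)^-1 *: x)) <= opnorm A.
  apply: sup_upper_bound; first exact: opnorm_has_sup.
  exists ((enorm x)^-1 *: x) => //=.
  by rewrite enormZ ger0_norm ?invr_ge0 ?enorm_ge0// mulVf ?gt_eqF.
rewrite -scalemxAr enormZ ger0_norm ?invr_ge0 ?enorm_ge0//.
by rewrite mulrC ler_pdivrMr.
Qed.

Lemma opbound_le m n (A : 'M[R]_(m, n)) a b : a <= b -> opbound A a -> opbound A b.
Proof. by move=> ab h x; rewrite (le_trans (h x))// ler_wpM2r ?enorm_ge0. Qed.

Lemma supnorm_opbound m n T (F : R -> 'M[R]_(m, n)) c t :
  (supnorm T F <= c%:E)%E -> t \in `[0, T] -> opbound (F t) c.
Proof.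
move=> h tT; apply: opbound_le (opbound_opnorm _).
rewrite -lee_fin (le_trans _ h)//; apply: ereal_sup_ubound.
by exists t.
Qed.

Lemma loewner_leE n (M N : 'M[R]_n) x : loewner_le M N -> dot x (M *m x) <= dot x (N *m x).
Proof. by move=> /(_ x); rewrite quadformE mulmxDl mulNmx dotDr dotNr subr_ge0. Qed.

Lemma dot_scalar_mx n (a : R) (x : 'cV[R]_n) : dot x (a%:M *m x) = a * enorm x ^+ 2.
Proof. by rewrite mul_scalar_mx dotZr enorm_sqr. Qed.

Lemma dot_opbound n (M : 'M[R]_n) c x : opbound M c ->
  dot x (M *m x) <= c * enorm x ^+ 2.
Proof.
move=> h; rewrite (le_trans (cauchy_schwarz _ _))// mulrC expr2 mulrA ler_wpM2r ?enorm_ge0//.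
Qed.

Lemma dot_opbound_ge n (M : 'M[R]_n) c x : opbound M c ->
  - (c * enorm x ^+ 2) <= dot x (M *m x).
Proof.
move=> h; rewrite lerNl -dotNr -mulNmx; apply: dot_opbound.
exact: opboundN.
Qed.

(** The discriminant of the nonnegative binary form [r, s |-> (r y - s x)^T S (r y - s x)]. Since
    [S] may be singular, the case where the form vanishes at [y] is separate. *)
Lemma psd_cauchy n (S : 'M[R]_n) x y : S^T = S -> (forall z, 0 <= dot z (S *m z)) ->
  dot y (S *m x) ^+ 2 <= dot y (S *m y) * dot x (S *m x).
Proof.
move=> Ssym S0.
set a := dot y (S *m y); set b := dot y (S *m x); set c := dot x (S *m x).
have bE : dot x (S *m y) = b by rewrite dot_mulr Ssym dotC.
have h r s : 0 <= r ^+ 2 * a - 2 * r * s * b + s ^+ 2 * c.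
  have := S0 (r *: y - s *: x).
  rewrite mulmxDr mulmxN -!scalemxAr dotDl !dotDr !dotNl !dotNr !dotZl !dotZr bE.
  rewrite -/a -/b -/c; congr (0 <= _); ring.
have a0 : 0 <= a by exact: S0.
have c0 : 0 <= c by exact: S0.
have [a00|an0] := eqVneq a 0.
  have [->|bn0] := eqVneq b 0; first by rewrite expr0n mulr_ge0.
  (* With [a = 0] the form is affine in [r]; this value of [r] makes it equal to [-1]. *)
  have := h ((c + 1) / (2 * b)) 1; rewrite a00.
  have -> : 2 * ((c + 1) / (2 * b)) * 1 * b = c + 1 by field.
  lra.
have := h b a.
have -> : b ^+ 2 * a - 2 * b * a * b + a ^+ 2 * c = a * (a * c - b ^+ 2) by ring.
by rewrite pmulr_rge0 ?subr_ge0// lt_neqAle eq_sym an0.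
Qed.

(** The Cauchy-Schwarz inequality of the form itself takes the place of a diagonalization. *)
Lemma psd_opbound n (S : 'M[R]_n) c : S^T = S -> (forall z, 0 <= dot z (S *m z)) ->
  (forall z, dot z (S *m z) <= c * enorm z ^+ 2) -> 0 <= c -> opbound S c.
Proof.
move=> Ssym S0 Sc c0 x; apply: enorm_le_dot => [|y].
  by rewrite mulr_ge0 ?enorm_ge0.
apply: (@le_trans _ _ `|dot y (S *m x)|); first exact: ler_norm.
rewrite -(@ler_pXn2r _ 2)// ?nnegrE ?mulr_ge0 ?enorm_ge0//.
rewrite real_normK ?num_real// (le_trans (psd_cauchy _ _ Ssym S0))//.
apply: (le_trans (ler_pM _ _ (Sc y) (Sc x))) => //.
by rewrite le_eqVlt; apply/orP; left; apply/eqP; ring.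
Qed.

Section coercive.
Variables (n : nat) (M : 'M[R]_n) (c : R).
Hypotheses (c0 : 0 < c) (Mc : forall x, c * enorm x ^+ 2 <= dot x (M *m x)).

(** A row of the left kernel of [M^T], once transposed, is annihilated by [M], and coercivity forces
    it to be zero. *)
Lemma coercive_unit : M \in unitmx.
Proof.
rewrite -unitmx_tr -row_free_unit -kermx_eq0; apply/eqP/row_matrixP => i.
rewrite row0; set v := row i _.
have vM : v *m M^T = 0 by rewrite -row_mul mulmx_ker row0.
have : c * enorm v^T ^+ 2 <= 0.
  apply: le_trans (Mc _) _.
  by rewrite -[M]trmxK -trmx_mul vM trmx0 dotE big1// => j _; rewrite [X in _ * X]mxE mulr0.
rewrite pmulr_rle0// => h.
have /enorm_eq0 : enorm v^T = 0.
  by apply/eqP; rewrite -sqrf_eq0; apply/eqP/le_anti; rewrite h sqr_ge0.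
by move/(congr1 trmx); rewrite trmxK trmx0.
Qed.

Lemma coercive_inv_dot x : 0 <= dot x (invmx M *m x).
Proof.
rewrite -{1}[x](mulKVmx coercive_unit) dotC; apply: le_trans (Mc _).
by rewrite mulr_ge0 ?sqr_ge0// ltW.
Qed.

Lemma coercive_inv_opbound : opbound (invmx M) c^-1.
Proof.
move=> x; set y := invmx M *m x; rewrite mulrC ler_pdivlMr//.
have := Mc y; rewrite {2}/y mulKVmx ?coercive_unit// => h.
have {h} := le_trans h (cauchy_schwarz _ _).
have := enorm_ge0 y; rewrite le_eqVlt => /predU1P[<- _|y0].
  by rewrite mul0r enorm_ge0.
by rewrite expr2 mulrCA ler_pM2l// mulrC.
Qed.

End coercive.

Lemma trmx_inv_sym n (M : 'M[R]_n) : M^T = M -> (invmx M)^T = invmx M.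
Proof. by move=> h; rewrite trmx_inv h. Qed.

End Euclid.

(** * Entrywise calculus of matrix functions *)

Section Calculus.
Variable R : realType.
Implicit Types (a b t : R) (f g : R -> R).

Definition mcont m n a b (X : R -> 'M[R]_(m, n)) :=
  forall i j, {within `[a, b], continuous (fun t => X t i j)}.

(** Derivatives are asked in the open interval only, which is what [solves_ode] gives and what the
    mean value theorem consumes. *)
Definition mC1 m n a b (X X' : R -> 'M[R]_(m, n)) :=
  mcont a b X /\ forall t, a < t < b ->
    forall i j, is_derive t (1 : R) (fun s => X s i j) (X' t i j).

Lemma within_sub a b c d f : a <= c -> d <= b ->
  {within `[a, b], continuous f} -> {within `[c, d], continuous f}.
Proof.
move=> ac db; apply: continuous_subspaceW; apply: subset_itvScc => //.
Qed.

Lemma within_sum n a b (h : 'I_n -> R -> R) :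
  (forall i, {within `[a, b], continuous (h i)}) ->
  {within `[a, b], continuous (fun t => \sum_i h i t)}.
Proof.
move=> hc; elim: n h hc => [|n ih] h hc.
  have -> : (fun t => \sum_i h i t) = (fun=> 0).
    by apply/funext => t; rewrite big_ord0.
  by move=> x; exact: cvg_cst.
have -> : (fun t => \sum_i h i t) =
    (fun t => \sum_i h (widen_ord (leqnSn n) i) t + h ord_max t).
  by apply/funext => t; rewrite big_ord_recr.
move=> x; apply: cvgD; [exact: (ih _ _)|exact: hc].
Qed.

Lemma withinM a b f g : {within `[a, b], continuous f} ->
  {within `[a, b], continuous g} -> {within `[a, b], continuous (fun t => f t * g t)}.
Proof. by move=> cf cg x; apply: cvgM; [exact: cf|exact: cg]. Qed.

Lemma mcont_within m n a b (X : R -> 'M[R]_(m, n)) :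
  {within `[a, b], continuous X} -> mcont a b X.
Proof.
move=> cX i j x; apply: (@continuous_comp _ _ _ (X : subspace _ -> _) (fun M => M i j)).
  exact: cX.
exact: coord_continuous.
Qed.

Lemma mcont_sub m n a b c d (X : R -> 'M[R]_(m, n)) : a <= c -> d <= b ->
  mcont a b X -> mcont c d X.
Proof. by move=> ac db cX i j; apply: within_sub (cX i j). Qed.

Lemma mcont_cst m n a b (M : 'M[R]_(m, n)) : mcont a b (fun=> M).
Proof. by move=> i j x; exact: cvg_cst. Qed.

Lemma mcontD m n a b (X Y : R -> 'M[R]_(m, n)) :
  mcont a b X -> mcont a b Y -> mcont a b (fun t => X t + Y t).
Proof.
move=> cX cY i j.
have -> : (fun t => (X t + Y t) i j) = (fun t => X t i j + Y t i j).
  by apply/funext => t; rewrite mxE.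
by move=> x; apply: cvgD; [exact: cX|exact: cY].
Qed.

Lemma mcontN m n a b (X : R -> 'M[R]_(m, n)) :
  mcont a b X -> mcont a b (fun t => - X t).
Proof.
move=> cX i j.
have -> : (fun t => (- X t) i j) = (fun t => - X t i j).
  by apply/funext => t; rewrite mxE.
by move=> x; apply: cvgN; exact: cX.
Qed.

Lemma mcontB m n a b (X Y : R -> 'M[R]_(m, n)) :
  mcont a b X -> mcont a b Y -> mcont a b (fun t => X t - Y t).
Proof. by move=> cX cY; apply: mcontD => //; exact: mcontN. Qed.

Lemma mcont_tr m n a b (X : R -> 'M[R]_(m, n)) :
  mcont a b X -> mcont a b (fun t => (X t)^T).
Proof.
move=> cX i j; have -> : (fun t => (X t)^T i j) = (fun t => X t j i).
  by apply/funext => t; rewrite mxE.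
exact: cX.
Qed.

Lemma mcontM m n p a b (X : R -> 'M[R]_(m, n)) (Y : R -> 'M[R]_(n, p)) :
  mcont a b X -> mcont a b Y -> mcont a b (fun t => X t *m Y t).
Proof.
move=> cX cY i j.
have -> : (fun t => (X t *m Y t) i j) = (fun t => \sum_k X t i k * Y t k j).
  by apply/funext => t; rewrite mxE.
by apply: within_sum => k; apply: withinM; [exact: cX|exact: cY].
Qed.

Lemma mC1_sub m n a b c d (X X' : R -> 'M[R]_(m, n)) : a <= c -> d <= b ->
  mC1 a b X X' -> mC1 c d X X'.
Proof.
move=> ac db [cX dX]; split; first exact: mcont_sub cX.
by move=> t /andP[ct td] i j; apply: dX; rewrite (le_lt_trans ac)// (lt_le_trans td).
Qed.

Lemma mC1_eq m n a b (X X' X'' : R -> 'M[R]_(m, n)) :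
  (forall t, a < t < b -> X' t = X'' t) -> mC1 a b X X' -> mC1 a b X X''.
Proof. by move=> e [cX dX]; split => // t tab i j; rewrite -e//; exact: dX. Qed.

Lemma solves_ode_mC1 m n T (X F : R -> 'M[R]_(m, n)) :
  solves_ode T X F -> mC1 0 T X F.
Proof.
move=> [cX dX]; split; first exact: mcont_within.
move=> t tT i j; have tT' : t \in `]0, T[ by rewrite in_itv.
have := dX t tT' => -[dXt <-].
rewrite derive_mx// mxE; apply: DeriveDef => //.
by move/derivable_mxP : dXt; exact.
Qed.

Lemma mC1_cst m n a b (M : 'M[R]_(m, n)) : mC1 a b (fun=> M) (fun=> 0).
Proof. by split => [|t _ i j]; [exact: mcont_cst|rewrite mxE; exact: is_derive_cst]. Qed.

Lemma mC1D m n a b (X X' Y Y' : R -> 'M[R]_(m, n)) :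
  mC1 a b X X' -> mC1 a b Y Y' -> mC1 a b (fun t => X t + Y t) (fun t => X' t + Y' t).
Proof.
move=> [cX dX] [cY dY]; split => [|t tab i j]; first exact: mcontD.
have -> : (fun t => (X t + Y t) i j) = (fun t => X t i j) + (fun t => Y t i j).
  by apply/funext => s; rewrite mxE.
by rewrite mxE; apply: is_deriveD; [exact: dX|exact: dY].
Qed.

Lemma mC1N m n a b (X X' : R -> 'M[R]_(m, n)) :
  mC1 a b X X' -> mC1 a b (fun t => - X t) (fun t => - X' t).
Proof.
move=> [cX dX]; split => [|t tab i j]; first exact: mcontN.
have -> : (fun t => (- X t) i j) = - (fun t => X t i j).
  by apply/funext => s; rewrite mxE.
by rewrite mxE; apply: is_deriveN; exact: dX.
Qed.

Lemma mC1B m n a b (X X' Y Y' : R -> 'M[R]_(m, n)) :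
  mC1 a b X X' -> mC1 a b Y Y' -> mC1 a b (fun t => X t - Y t) (fun t => X' t - Y' t).
Proof. by move=> hX hY; apply: mC1D => //; exact: mC1N. Qed.

Lemma mC1_tr m n a b (X X' : R -> 'M[R]_(m, n)) :
  mC1 a b X X' -> mC1 a b (fun t => (X t)^T) (fun t => (X' t)^T).
Proof.
move=> [cX dX]; split => [|t tab i j]; first exact: mcont_tr.
have -> : (fun t => (X t)^T i j) = (fun t => X t j i).
  by apply/funext => s; rewrite mxE.
by rewrite mxE; exact: dX.
Qed.

Lemma mC1M m n p a b (X X' : R -> 'M[R]_(m, n)) (Y Y' : R -> 'M[R]_(n, p)) :
  mC1 a b X X' -> mC1 a b Y Y' ->
  mC1 a b (fun t => X t *m Y t) (fun t => X' t *m Y t + X t *m Y' t).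
Proof.
move=> [cX dX] [cY dY]; split => [|t tab i j]; first exact: mcontM.
have -> : (fun t => (X t *m Y t) i j) =
    \sum_k ((fun t => X t i k) * (fun t => Y t k j)).
  by apply/funext => s; rewrite mxE fct_sumE.
rewrite !mxE -big_split/=.
apply: is_derive_sum => k.
apply: is_derive_eq; first by apply: is_deriveM; [exact: dX|exact: dY].
by rewrite /GRing.scale /= addrC mulrC [X in _ + X]mulrC [X in _ = X]addrC mulrC addrC.
Qed.

End Calculus.

(** * Scalar calculus *)

Section ScalarC1.
Variable R : realType.
Implicit Types (a b t : R) (f g : R -> R).

Definition C1 a b f f' :=
  {within `[a, b], continuous f} /\ forall t, a < t < b -> is_derive t (1 : R) f (f' t).

Lemma C1_sub a b c d f f' : a <= c -> d <= b -> C1 a b f f' -> C1 c d f f'.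
Proof.
move=> ac db [cX dX]; split; first exact: within_sub cX.
by move=> t /andP[ct td]; apply: dX; rewrite (le_lt_trans ac)// (lt_le_trans td).
Qed.

Lemma C1_eq a b f f' g' : (forall t, a < t < b -> f' t = g' t) -> C1 a b f f' -> C1 a b f g'.
Proof. by move=> e [cf df]; split => // t tab; rewrite -e//; exact: df. Qed.

Lemma C1D a b f f' g g' : C1 a b f f' -> C1 a b g g' ->
  C1 a b (fun t => f t + g t) (fun t => f' t + g' t).
Proof.
move=> [cf df] [cg dg]; split => [x|t tab]; first by apply: cvgD; [exact: cf|exact: cg].
by apply: is_deriveD; [exact: df|exact: dg].
Qed.

Lemma C1M a b f f' g g' : C1 a b f f' -> C1 a b g g' ->
  C1 a b (fun t => f t * g t) (fun t => f' t * g t + f t * g' t).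
Proof.
move=> [cf df] [cg dg]; split => [|t tab]; first exact: withinM.
apply: is_derive_eq; first by apply: is_deriveM; [exact: df|exact: dg].
by rewrite /GRing.scale /= addrC mulrC.
Qed.

Lemma C1_cst a b c : C1 a b (fun=> c) (fun=> 0).
Proof. by split => [x|t _]; [exact: cvg_cst|exact: is_derive_cst]. Qed.

Lemma C1Z a b c f f' : C1 a b f f' -> C1 a b (fun t => c * f t) (fun t => c * f' t).
Proof.
move=> h; apply: C1_eq (C1M (C1_cst a b c) h) => t _; by rewrite mul0r add0r.
Qed.

Lemma C1B a b f f' g g' : C1 a b f f' -> C1 a b g g' ->
  C1 a b (fun t => f t - g t) (fun t => f' t - g' t).
Proof.
move=> [cf df] [cg dg]; split => [x|t tab]; first by apply: cvgB; [exact: cf|exact: cg].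
by apply: is_deriveB; [exact: df|exact: dg].
Qed.

Lemma is_derive_expR_affine (k s t : R) :
  is_derive t (1 : R) (fun t => expR (k * (t - s))) (k * expR (k * (t - s))).
Proof.
have hl : is_derive t (1 : R) (fun t => k * (t - s)) k.
  have h1 : is_derive t (1 : R) (fun t => t - s) (1 - 0).
    by apply: is_deriveB; exact: is_derive_cst.
  have h2 := is_deriveM (is_derive_cst k t (1 : R)) h1.
  by apply: is_derive_eq h2 _; rewrite scaler0 addr0 subr0 /GRing.scale /= mulr1.
rewrite mulrC.
exact: (@is_derive1_comp _ expR (fun t => k * (t - s)) t _ _ (is_derive_expR _) hl).
Qed.

Lemma C1_expR a b (k s : R) :
  C1 a b (fun t => expR (k * (t - s))) (fun t => k * expR (k * (t - s))).
Proof.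
split => [|t _]; last exact: is_derive_expR_affine.
apply: continuous_subspaceT => t; apply: differentiable_continuous.
by apply/derivable1_diffP; have [] := is_derive_expR_affine k s t.
Qed.

Lemma C1_le a b f f' : C1 a b f f' -> (forall t, a < t < b -> 0 <= f' t) ->
  a <= b -> f a <= f b.
Proof.
move=> [cf df] f'0 ab.
apply: (@ger0_derive1_le_cc _ f a b) => //.
- by move=> t; rewrite in_itv/= => /df[].
- by move=> t; rewrite in_itv/= => tab; rewrite derive1E (@derive_val _ _ _ _ _ _ _ (df t tab)) f'0.
- by rewrite in_itv/= lexx.
- by rewrite in_itv/= lexx andbT.
Qed.

(** The product [expR (- k (t - a)) * f t] is nonincreasing. The signs of [f] and [k] are arbitrary,
    so the same lemma gives growth and decay. *)
Lemma gronwall a b f f' k : C1 a b f f' -> (forall t, a < t < b -> f' t <= k * f t) ->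
  a <= b -> f b <= expR (k * (b - a)) * f a.
Proof.
move=> hf f'k ab.
have := C1_le (C1Z (-1) (C1M (C1_expR a b (- k) a) hf)).
rewrite subrr mulr0 expR0 mul1r => h.
rewrite -[X in X <= _](mulKf (lt0r_neq0 (expR_gt0 (- k * (b - a))))).
rewrite -expRN mulNr opprK ler_pM2l ?expR_gt0// -mulNr.
have {h} : -1 * f a <= -1 * (expR (- k * (b - a)) * f b).
  apply: h => // t tab.
  have := f'k t tab; have := expR_gt0 (- k * (t - a)) => e0 h.
  have -> : -1 * (- k * expR (- k * (t - a)) * f t + expR (- k * (t - a)) * f' t)
      = expR (- k * (t - a)) * (k * f t - f' t) by ring.
  by rewrite mulr_ge0 ?subr_ge0// ltW.
by rewrite !mulN1r lerN2.
Qed.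

Lemma gronwall_ge a b f f' k : C1 a b f f' -> (forall t, a < t < b -> k * f t <= f' t) ->
  a <= b -> expR (k * (b - a)) * f a <= f b.
Proof.
move=> hf f'k ab.
have := @gronwall a b (fun t => -1 * f t) (fun t => -1 * f' t) k (C1Z (-1) hf).
rewrite !mulN1r mulrN lerN2; apply=> // t tab.
by rewrite !mulN1r mulrN lerN2 f'k.
Qed.

Lemma C1_sum n a b (h h' : 'I_n -> R -> R) : (forall i, C1 a b (h i) (h' i)) ->
  C1 a b (fun t => \sum_i h i t) (fun t => \sum_i h' i t).
Proof.
move=> H; split => [|t tab]; first by apply: within_sum => i; have [] := H i.
rewrite (_ : (fun t => _) = \sum_i h i); last by apply/funext => s; rewrite fct_sumE.
by apply: is_derive_sum => i; have [_] := H i; exact.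
Qed.

Lemma mC1_entry m n a b (X X' : R -> 'M[R]_(m, n)) i j : mC1 a b X X' ->
  C1 a b (fun t => X t i j) (fun t => X' t i j).
Proof. by move=> [cX dX]; split => // t tab; exact: dX. Qed.

Lemma C1_dot n a b (x x' y y' : R -> 'cV[R]_n) : mC1 a b x x' -> mC1 a b y y' ->
  C1 a b (fun t => dot (x t) (y t)) (fun t => dot (x' t) (y t) + dot (x t) (y' t)).
Proof.
move=> hx hy.
rewrite (_ : (fun t => dot (x t) (y t)) = (fun t => \sum_i x t i 0 * y t i 0)); last first.
  by apply/funext => t; rewrite dotE.
apply: C1_eq (C1_sum (fun i => C1M (mC1_entry i 0 hx) (mC1_entry i 0 hy))) => t _.
by rewrite !dotE -big_split.
Qed.

Lemma cvg_is_derive f t l :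
  (h^-1 *: (f (h *: 1 + t) - f t)) @[h --> 0^'] --> l -> is_derive t (1 : R) f l.
Proof.
move=> h; apply: DeriveDef; first exact: (cvgP l).
exact: (cvg_lim _ h).
Qed.

Lemma is_derive_cvg f t l : is_derive t (1 : R) f l ->
  (h^-1 *: (f (h *: 1 + t) - f t)) @[h --> 0^'] --> l.
Proof. by move=> [/[swap] <-]; exact. Qed.

Lemma near_shift (t : R) (P : R -> Prop) : (\forall s \near t, P s) ->
  \forall h \near 0^', P (h *: 1 + t).
Proof.
move=> /nbhs_ballP[e /= e0 he]; near=> h.
apply: he; rewrite /ball/= opprD addrC addrNK normrN [_ *: 1]mulr1.
by near: h; apply: dnbhs0_lt.
Unshelve. all: by end_near. Qed.

(** Because [w] vanishes at [t], the difference quotient of the product is [g] times that of [w], so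
    continuity of [g] suffices. This avoids a circularity when an inverse matrix is
    differentiated. *)
Lemma is_derive_vanishing_factor g w t dw : {for t, continuous g} -> w t = 0 ->
  is_derive t (1 : R) w dw -> is_derive t (1 : R) (fun s => g s * w s) (g t * dw).
Proof.
move=> cg w0 dw_; apply: cvg_is_derive.
have -> : (fun h : R => h^-1 *: (g (h *: 1 + t) * w (h *: 1 + t) - g t * w t)) =
    (fun h => g (h *: 1 + t) * (h^-1 *: (w (h *: 1 + t) - w t))).
  by apply/funext => h; rewrite w0 mulr0 !subr0 /GRing.scale/= mulrCA.
apply: cvgM; last exact: is_derive_cvg.
apply/cvgrPdist_le => e e0; move/cvgrPdist_le : cg => /(_ e e0) /near_shift.
exact.
Qed.

Lemma is_derive_near f g t l : (\forall s \near t, g s = f s) ->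
  is_derive t (1 : R) g l -> is_derive t (1 : R) f l.
Proof.
move=> fg /is_derive_cvg h; apply: cvg_is_derive.
apply: cvg_trans h; apply: near_eq_cvg.
have ft := nbhs_singleton fg.
have := near_shift fg; apply: filterS => h ->.
by rewrite ft.
Qed.

(** From [Y s - Y r = Y s (X r - X s) Y r], the uniform bound on the entries of [Y] transfers the
    modulus of continuity of [X] to [Y]. *)
Lemma mcont_inv n a b (X Y : R -> 'M[R]_n) C : mcont a b X ->
  (forall t, t \in `[a, b] -> Y t *m X t = 1%:M) ->
  (forall t, t \in `[a, b] -> forall i j, `|Y t i j| <= C) ->
  mcont a b Y.
Proof.
move=> cX YX YC i j.
apply/subspace_continuousP => r rab.
have rab' : r \in `[a, b] by [].
(* An entrywise majorant of [Y s - Y r] that is continuous and vanishes at [r]. *)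
pose h s := \sum_k \sum_l C * `|X r k l - X s k l| * C.
have hr : h r = 0.
  by rewrite /h big1// => k _; rewrite big1// => l _; rewrite subrr normr0 mulr0 mul0r.
have ch : {within `[a, b], continuous h}.
  apply: within_sum => k; apply: within_sum => l x.
  apply: cvgM; last exact: cvg_cst.
  apply: cvgM; first exact: cvg_cst.
  by apply: cvg_norm; apply: cvgB; [exact: cvg_cst|exact: cX].
have C0 : 0 <= C by apply: le_trans (YC r rab' i j).
have YE s : s \in `[a, b] -> Y s - Y r = Y s *m (X r - X s) *m Y r.
  move=> sab; rewrite mulmxBr mulmxBl YX// mul1mx -mulmxA.
  by rewrite (mulmx1C (YX r rab')) mulmx1.
have key s : s \in `[a, b] -> `|Y r i j - Y s i j| <= h s.
  move=> sab; rewrite distrC (_ : Y s i j - Y r i j = (Y s - Y r) i j); last by rewrite !mxE.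
  rewrite YE// -mulmxA mxE (le_trans (ler_norm_sum _ _ _))//; apply: ler_sum => k _.
  rewrite mxE mulr_sumr (le_trans (ler_norm_sum _ _ _))//; apply: ler_sum => l _.
  rewrite !normrM mulrA; apply: ler_pM; rewrite ?mulr_ge0 ?YC//.
  rewrite !mxE; apply: ler_pM => //; exact: YC.
move/subspace_continuousP : ch => /(_ r rab) /cvgrPdist_le ch.
apply/cvgrPdist_le => e e0; have {}ch := ch e e0.
near=> s.
apply: le_trans (key s _) _.
  by near: s; exact: withinT.
have : `|h r - h s| <= e by near: s.
by rewrite hr sub0r normrN; apply: le_trans; exact: ler_norm.
Unshelve. all: by end_near. Qed.

Lemma opbound_entry m n (M : 'M[R]_(m, n)) c i j : opbound M c -> `|M i j| <= c.
Proof.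
move=> /(_ (delta_mx j 0)) h.
have := le_trans (normr_entry_le (M *m delta_mx j 0) i) h.
rewrite -colE mxE.
suff -> : enorm (delta_mx j 0 : 'cV[R]_n) = 1 by rewrite mulr1.
rewrite /enorm (bigD1 j)//= big1 => [|l lj]; first by rewrite !mxE !eqxx expr1n addr0 sqrtr1.
by rewrite !mxE (negbTE lj) expr0n.
Qed.

(** Same identity: in [Y s = Y r + Y s (X r - X s) Y r] the factor [(X r - X s) Y r] vanishes at
    [r], so the continuity of [Y] just established is enough to differentiate the product. *)
Lemma mC1_inv n a b (X X' Y : R -> 'M[R]_n) C : mC1 a b X X' ->
  (forall t, t \in `[a, b] -> Y t *m X t = 1%:M) ->
  (forall t, t \in `[a, b] -> forall i j, `|Y t i j| <= C) ->
  mC1 a b Y (fun t => - (Y t *m X' t *m Y t)).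
Proof.
move=> [cX dX] YX YC; have cY := mcont_inv cX YX YC.
split => // r rab i j.
have rab' : r \in `]a, b[ by rewrite in_itv.
have ab : a < b by case/andP : rab => ? ?; apply: lt_trans; eassumption.
have ab' t : a < t < b -> t \in `[a, b] by rewrite in_itv/= => /andP[/ltW-> /ltW->].
pose W s := (X r - X s) *m Y r.
have W0 k : W r k j = 0 by rewrite /W subrr mul0mx mxE.
have dW k : is_derive r (1 : R) (fun s => W s k j) ((- X' r *m Y r) k j).
  have hX : mC1 a b X X' by [].
  have := mC1M (mC1B (mC1_cst a b (X r)) hX) (mC1_cst a b (Y r)).
  by move=> [_ /(_ r rab k j)]; rewrite mulmx0 addr0 sub0r.
pose g s := Y r i j + \sum_k Y s i k * W s k j.
apply: (@is_derive_near _ g).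
  have := near_in_itvoo rab'; apply: filterS => s; rewrite in_itv/= => /ab' sab.
  have : Y s - Y r = Y s *m W s.
    by rewrite /W mulmxA mulmxBr mulmxBl YX// mul1mx -mulmxA (mulmx1C (YX _ (ab' _ rab))) mulmx1.
  by move/matrixP/(_ i j); rewrite !mxE /g => <-; rewrite addrCA subrr addr0.
have -> : (- (Y r *m X' r *m Y r)) i j = 0 + \sum_k Y r i k * ((- X' r *m Y r) k j).
  by rewrite add0r -mulmxA -mulmxN mxE; apply: eq_bigr => k _; rewrite mulNmx.
apply: is_deriveD.
rewrite (_ : (fun t => _) = \sum_k (fun s => Y s i k * W s k j)); last first.
  by apply/funext => s; rewrite fct_sumE.
apply: is_derive_sum => k; apply: is_derive_vanishing_factor => //.
exact: (within_continuous_continuous ab (cY i k)).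
Qed.

End ScalarC1.

(** * Linear differential equations *)

Section LinearODE.
Variables (R : realType) (n : nat) (T L : R) (M : R -> 'M[R]_n).
Hypothesis L0 : 0 <= L.
Hypothesis ML : forall t, t \in `[0, T] -> opbound (M t) L.

(** Both [|y|^2] growing at rate at most [2 L] and decreasing at rate at most [2 L] are used,
    because [t] may lie before [s]. *)
Lemma ode_growth (y : R -> 'cV[R]_n) s t : mC1 0 T y (fun r => M r *m y r) ->
  s \in `[0, T] -> t \in `[0, T] -> enorm (y t) <= expR (L * `|t - s|) * enorm (y s).
Proof.
move=> hy; rewrite !in_itv/= => /andP[s0 sT] /andP[t0 tT].
have sq a b r : enorm (y a) ^+ 2 <= expR (2 * L * r) * enorm (y b) ^+ 2 ->
    enorm (y a) <= expR (L * r) * enorm (y b).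
  move=> h; rewrite -(@ler_pXn2r _ 2)// ?nnegrE ?mulr_ge0 ?enorm_ge0 ?expR_ge0//.
  apply: le_trans h _; rewrite exprMn -expRM_natl.
  by rewrite mulrA.
apply: sq; rewrite !enorm_sqr.
have [st|ts] := leP s t.
- rewrite ger0_norm ?subr_ge0//.
  apply: (gronwall (C1_sub s0 tT (C1_dot hy hy))) => // r /andP[sr rt].
  have rT : r \in `[0, T] by rewrite in_itv/= (le_trans s0 (ltW sr)) (le_trans (ltW rt) tT).
  rewrite (dotC (M r *m _)) -enorm_sqr.
  have := dot_opbound (y r) (ML rT); lra.
- rewrite ltr0_norm ?subr_lt0// opprB.
  have := gronwall_ge (k := - (2 * L)) (C1_sub t0 sT (C1_dot hy hy)).
  move=> h; rewrite -[leLHS](mulKf (lt0r_neq0 (expR_gt0 (- (2 * L * (s - t)))))).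
  rewrite -expRN opprK ler_pM2l ?expR_gt0// -mulNr.
  apply: h; last exact: ltW.
  move=> r /andP[tr rs].
  have rT : r \in `[0, T] by rewrite in_itv/= (le_trans t0 (ltW tr)) (le_trans (ltW rs) sT).
  rewrite (dotC (M r *m _)) -enorm_sqr.
  have := dot_opbound_ge (y r) (ML rT); lra.
Qed.

Lemma mulmx_colP m p (A B : 'M[R]_(m, p)) : (forall x : 'cV_p, A *m x = B *m x) -> A = B.
Proof.
move=> h; apply/matrixP => i j.
by have /colP/(_ i) := h (delta_mx j 0); rewrite -!colE !mxE.
Qed.

Lemma ode_unique m (Y Y' : R -> 'M[R]_(n, m)) s t :
  mC1 0 T Y (fun r => M r *m Y r) -> mC1 0 T Y' (fun r => M r *m Y' r) ->
  s \in `[0, T] -> t \in `[0, T] -> Y s = Y' s -> Y t = Y' t.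
Proof.
move=> hY hY' sT tT e; apply: mulmx_colP => x; apply/eqP; rewrite -subr_eq0; apply/eqP.
apply: enorm_eq0; apply/le_anti; rewrite enorm_ge0 andbT.
have hx : mC1 0 T (fun r => Y r *m x - Y' r *m x) (fun r => M r *m (Y r *m x - Y' r *m x)).
  apply: mC1_eq (mC1B (mC1M hY (mC1_cst 0 T x)) (mC1M hY' (mC1_cst 0 T x))) => r _.
  by rewrite !mulmx0 !addr0 mulmxBr !mulmxA.
by have := ode_growth hx sT tT; rewrite e subrr enorm0 mulr0.
Qed.

Variable Phi : R -> R -> 'M[R]_n.
Hypothesis HPhi : is_evolution T M Phi.

Lemma evol1 s : s \in `[0, T] -> Phi s s = 1%:M.
Proof. by move/HPhi => []. Qed.

Lemma evol_mC1 s : s \in `[0, T] -> mC1 0 T (fun t => Phi t s) (fun t => M t *m Phi t s).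
Proof. by move/HPhi => [_ /solves_ode_mC1]. Qed.

Lemma evol_mC1v s (x : 'cV[R]_n) : s \in `[0, T] ->
  mC1 0 T (fun t => Phi t s *m x) (fun t => M t *m (Phi t s *m x)).
Proof.
move=> sT; apply: mC1_eq (mC1M (evol_mC1 sT) (mC1_cst 0 T x)) => t _.
by rewrite mulmx0 addr0 mulmxA.
Qed.

Lemma evol_opbound s t : s \in `[0, T] -> t \in `[0, T] ->
  opbound (Phi t s) (expR (L * `|t - s|)).
Proof.
move=> sT tT x; have := ode_growth (evol_mC1v x sT) sT tT.
by rewrite evol1// mul1mx.
Qed.

Lemma evol_comp r s t : r \in `[0, T] -> s \in `[0, T] -> t \in `[0, T] ->
  Phi t s *m Phi s r = Phi t r.
Proof.
move=> rT sT tT.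
apply: (@ode_unique _ (fun t => Phi t s *m Phi s r) (fun t => Phi t r) s) => //.
- apply: mC1_eq (mC1M (evol_mC1 sT) (mC1_cst 0 T (Phi s r))) => q _.
  by rewrite mulmx0 addr0 mulmxA.
- exact: evol_mC1.
- by rewrite evol1// mul1mx.
Qed.

(** As a function of [s], [Phi t s] is the inverse of [Phi s t], whose derivative in [s] is known;
    the growth estimate supplies the uniform bound that [mC1_inv] requires. *)
Lemma evol_mC1_right t : t \in `[0, T] ->
  mC1 0 T (fun s => Phi t s) (fun s => - (Phi t s *m M s)).
Proof.
move=> tT.
have inv s : s \in `[0, T] -> Phi t s *m Phi s t = 1%:M.
  by move=> sT; rewrite evol_comp// evol1.
have bd s : s \in `[0, T] -> forall i j, `|Phi t s i j| <= expR (L * T).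
  move=> sT i j; apply: (le_trans (opbound_entry _ _ (evol_opbound sT tT))).
  rewrite ler_expR ler_wpM2l//.
  move: sT tT; rewrite !in_itv/= ler_norml => /andP[? ?] /andP[? ?].
  by apply/andP; split; lra.
apply: mC1_eq (mC1_inv (evol_mC1 tT) inv bd) => s /andP[s0 sT].
have sT' : s \in `[0, T] by rewrite in_itv/= !ltW.
by rewrite -!mulmxA evol_comp// evol1// mulmx1.
Qed.

End LinearODE.

(** * Lebesgue integrals *)

Section ScalarIntegral.
Variable R : realType.
Notation mu := (@lebesgue_measure R).
Implicit Types (a b c t : R) (f g : R -> R).

Lemma cont_integrable a b f : {within `[a, b], continuous f} ->
  mu.-integrable `[a, b] (EFin \o f).
Proof. by move=> cf; apply: continuous_compact_integrable => //; exact: segment_compact. Qed.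

Lemma integrable_sub a b c d f : a <= c -> d <= b ->
  mu.-integrable `[a, b] (EFin \o f) -> mu.-integrable `[c, d] (EFin \o f).
Proof.
move=> ac db; apply: integrableS => //.
by apply: subset_itvScc.
Qed.

Lemma Rintegral_split a b c f : a <= c -> c <= b -> mu.-integrable `[a, b] (EFin \o f) ->
  \int[mu]_(x in `[a, b]) f x = \int[mu]_(x in `[a, c]) f x + \int[mu]_(x in `[c, b]) f x.
Proof.
move=> ac cb hf; apply/eqP; rewrite addrC -subr_eq; apply/eqP.
rewrite Rintegral_itvB ?bnd_simp//.
rewrite Rintegral_itv_obnd_cbnd//.
have hf' := integrable_sub ac (lexx b) hf.
by apply: integrableS hf' => //; exact: subset_itv_oc_cc.
Qed.

Lemma Rintegral_cst a b c : a <= b -> \int[mu]_(x in `[a, b]) c = c * (b - a).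
Proof.
rewrite le_eqVlt => /predU1P[->|ab].
  by rewrite set_itv1 Rintegral_set1 subrr mulr0.
rewrite Rintegral_cst//; congr (_ * _).
have h := @lebesgue_measure_itv R `[a, b]; rewrite /= lte_fin ab -EFinB in h.
by rewrite [X in fine X]h.
Qed.

Lemma Rintegral_C1 a b f f' : a <= b -> C1 a b f f' -> {within `[a, b], continuous f'} ->
  \int[mu]_(x in `[a, b]) f' x = f b - f a.
Proof.
rewrite le_eqVlt => /predU1P[<- _ _|ab [cf df] cf'].
  by rewrite set_itv1 Rintegral_set1 subrr.
have h := @continuous_FTC2 R f' f a b ab cf'.
rewrite /Rintegral h//=.
- have [_ c1 c2] := (continuous_within_itvP f ab).1 cf.
  split => // t; rewrite in_itv/= => /df [].
  by [].
- move=> t; rewrite in_itv/= => /df dft; rewrite derive1E.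
  by rewrite derive_val.
Qed.

Lemma C1_Rintegral a b f : a <= b -> {within `[a, b], continuous f} ->
  C1 a b (fun t => \int[mu]_(x in `[a, t]) f x) f.
Proof.
move=> ab cf; split; first exact: parameterized_integral_continuous ab (cont_integrable cf).
move=> t tab; have [at_ tb] := andP tab.
have ab' := lt_trans at_ tb.
have ct : {for t, continuous f}.
  by apply: within_continuous_continuous cf _ => //; rewrite in_itv.
have [d1 d2] := continuous_FTC1_closed tb (cont_integrable cf) at_ ct.
apply: DeriveDef; first exact: d1.
by rewrite -derive1E; exact: d2.
Qed.

(** Bisecting an interval halves the factor [s - r] on both pieces while the increments of [N] add
    up again, so each bisection gains a factor 2 in the bound on [f b - f a]. *)
Lemma oscillation_const a b f N C : a <= b -> 0 <= C ->
  (forall r s, a <= r -> r <= s -> s <= b -> `|f s - f r| <= C * (s - r) * (N s - N r)) ->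
  f b = f a.
Proof.
move=> ab C0 H.
(* Quantifying over all subintervals lets the induction hypothesis be applied to both halves. *)
have key n : forall r s, a <= r -> r <= s -> s <= b ->
    2 ^+ n * `|f s - f r| <= C * (s - r) * (N s - N r).
  elim: n => [r s ar rs sb|n ih r s ar rs sb]; first by rewrite mul1r; exact: H.
  pose m := (r + s) / 2.
  have rm : r <= m by rewrite /m; lra.
  have ms : m <= s by rewrite /m; lra.
  have h1 := ih r m ar rm (le_trans ms sb).
  have h2 := ih m s (le_trans ar rm) ms sb.
  have h3 : `|f s - f r| <= `|f s - f m| + `|f m - f r|.
    by rewrite -[X in `|X|](subrKA (f m)) ler_normD.
  have p0 : 0 <= (2 : R) ^+ n by rewrite exprn_ge0.
  have e1 : m - r = (s - r) / 2 by rewrite /m; lra.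
  have e2 : s - m = (s - r) / 2 by rewrite /m; lra.
  rewrite e1 in h1; rewrite e2 in h2.
  have h4 := ler_wpM2l p0 h3.
  rewrite exprS; lra.
apply/eqP; rewrite -subr_eq0; apply/negPn/negP => ne0.
set K := C * (b - a) * (N b - N a).
have d0 : 0 < `|f b - f a| by rewrite normr_gt0.
have h n : 2 ^+ n <= K / `|f b - f a|.
  by rewrite ler_pdivlMr// key.
pose q := K / `|f b - f a|.
have q0 : 0 <= q by apply: le_trans (h 0%N); rewrite expr0.
(* A fixed [q] cannot dominate every [2 ^+ n]: some [n] exceeds it, and [n < 2 ^ n]. *)
have [n hn] : exists n : nat, q < n%:R.
  by exists (Num.bound q); exact: archi_boundP.
have := h n; rewrite leNgt => /negP; apply.
rewrite -/q (lt_le_trans hn)// -natrX ler_nat.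
exact/ltnW/ltn_expl.
Qed.

Lemma integrable_scale D c f : measurable D -> mu.-integrable D (EFin \o f) ->
  mu.-integrable D (EFin \o (fun x => c * f x)).
Proof.
move=> mD hf; rewrite (_ : EFin \o _ = (fun x => c%:E * (EFin \o f) x)%E).
  exact: integrableZl.
by apply/funext.
Qed.

Lemma integrable_addr D f g : measurable D -> mu.-integrable D (EFin \o f) ->
  mu.-integrable D (EFin \o g) -> mu.-integrable D (EFin \o (fun x => f x + g x)).
Proof.
move=> mD hf hg; rewrite (_ : EFin \o _ = (EFin \o f) \+ (EFin \o g))%E//.
exact: integrableD.
Qed.

Lemma integrable_cont_mul a b f g : {within `[a, b], continuous f} ->
  mu.-integrable `[a, b] (EFin \o g) ->
  mu.-integrable `[a, b] (EFin \o (fun x => f x * g x)).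
Proof.
move=> cf hg.
have [K [_ hK]] : [bounded f x | x in `[a, b]].
  have := compact_bounded (continuous_compact cf (@segment_compact _ a b)).
  by move=> [K [Kr hK]]; exists K; split => // x /hK {}hK y yab; apply: hK; exists y.
have mf : measurable_fun `[a, b] f by apply/measurable_EFinP; exact: (measurable_int mu (cont_integrable cf)).
have mg : measurable_fun `[a, b] g by apply/measurable_EFinP; exact: (measurable_int mu hg).
(* Boundedness gives a bound by every number strictly above [K], hence the [+ 1]. *)
apply: (@le_integrable _ _ _ mu `[a, b] (measurable_itv _) _ (EFin \o (fun x => (`|K| + 1) * `|g x|))) => //.
- by apply/measurable_EFinP; exact: measurable_funM.
- move=> x xab /=; rewrite lee_fin normrM normrM normr_id ler_wpM2r//.
  rewrite (le_trans (hK (`|K| + 1) _ x xab))//.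
    by rewrite (le_lt_trans (ler_norm K))// ltrDl.
  exact: ler_norm.
- apply: integrable_scale => //.
  by have := integrable_abse hg; apply.
Qed.

Lemma Rintegral_sum D n (h : 'I_n -> R -> R) : measurable D ->
  (forall i, mu.-integrable D (EFin \o h i)) ->
  mu.-integrable D (EFin \o (fun x => \sum_i h i x)) /\
  \int[mu]_(x in D) (\sum_i h i x) = \sum_i \int[mu]_(x in D) h i x.
Proof.
move=> mD; elim: n h => [|n ih] h hi.
  have -> : (fun x => \sum_i h i x) = (fun=> 0).
    by apply/funext => x; rewrite big_ord0.
  split; first exact: integrable0.
  by rewrite big_ord0 /Rintegral integral0.
have e : (fun x => \sum_i h i x) =
    (fun x => \sum_i h (widen_ord (leqnSn n) i) x + h ord_max x).
  by apply/funext => x; rewrite big_ord_recr.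
have [h1 h2] := ih (fun i => h (widen_ord (leqnSn n) i)) (fun i => hi _).
rewrite e; split; first exact: integrable_addr.
by rewrite RintegralD// h2 big_ord_recr.
Qed.

Lemma integrable_norm D f : measurable D -> mu.-integrable D (EFin \o f) ->
  mu.-integrable D (EFin \o (fun x => `|f x|)).
Proof. by move=> mD hf; have := integrable_abse hf; apply. Qed.

(* With [N] the integral of [|f|], the defect of the claimed identity over [r, s] is
   at most [2 K (s - r) (N s - N r)], hence vanishes under repeated halving. *)
Lemma by_parts_abs_cont a b (m m' f X : R -> R) : a <= b ->
  C1 a b m m' -> {within `[a, b], continuous m'} ->
  mu.-integrable `[a, b] (EFin \o f) ->
  (forall t, a <= t <= b -> X t = X a + \int[mu]_(x in `[a, t]) f x) ->
  mu.-integrable `[a, b] (EFin \o (fun t => m' t * X t + m t * f t)) /\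
  \int[mu]_(t in `[a, b]) (m' t * X t + m t * f t) = m b * X b - m a * X a.
Proof.
move=> ab hm cm' hf hX.
have cX : {within `[a, b], continuous X}.
  have c1 := parameterized_integral_continuous ab hf.
  apply/subspace_continuousP => r rab.
  move/subspace_continuousP : c1 => /(_ r rab) => c1.
  have rab' : a <= r <= b by move: rab; rewrite /= in_itv.
  suff : X @ within `[a, b] (nbhs r) --> X a + \int[mu]_(x in `[a, r]) f x by rewrite -hX.
  apply: cvg_trans (cvgD (cvg_cst (X a)) c1).
  apply: near_eq_cvg; near=> t; rewrite /= (hX t)//.
  have : `[a, b]%classic t by near: t; apply: withinT.
  by rewrite /= in_itv.
have [cm _] := hm.
have i1 : mu.-integrable `[a, b] (EFin \o (fun t => m' t * X t)).
  by apply: cont_integrable; exact: withinM.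
have i2 : mu.-integrable `[a, b] (EFin \o (fun t => m t * f t)).
  exact: integrable_cont_mul.
have i12 := integrable_addr (measurable_itv _) i1 i2.
split => //.
have [K [_ hK]] : [bounded m' x | x in `[a, b]].
  have := compact_bounded (continuous_compact cm' (@segment_compact _ a b)).
  by move=> [K [Kr hK]]; exists K; split => // x /hK {}hK y yab; apply: hK; exists y.
pose C := `|K| + 1.
have C0 : 0 <= C by rewrite addr_ge0.
have mC t : a <= t <= b -> `|m' t| <= C.
  move=> tab; apply: hK; last by rewrite /= in_itv.
  by rewrite (le_lt_trans (ler_norm K))// ltrDl.
pose N t := \int[mu]_(x in `[a, t]) `|f x|.
have hfn := integrable_norm (measurable_itv _) hf.
pose E t := m t * X t - \int[mu]_(t in `[a, t]) (m' t * X t + m t * f t).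
suff : E b = E a.
  rewrite /E set_itv1 Rintegral_set1 subr0 => /eqP; rewrite subr_eq => /eqP ->.
  by rewrite [X in _ = X - _]addrC addrK.
apply: (@oscillation_const a b E N (2 * C)) => //; first by rewrite mulr_ge0.
move=> r s ar rs sb.
have rb := le_trans rs sb; have as_ := le_trans ar rs.
have sub g : mu.-integrable `[a, b] (EFin \o g) -> mu.-integrable `[r, s] (EFin \o g).
  exact: integrable_sub.
have spl g : mu.-integrable `[a, b] (EFin \o g) ->
    \int[mu]_(x in `[a, s]) g x - \int[mu]_(x in `[a, r]) g x = \int[mu]_(x in `[r, s]) g x.
  move=> hg; rewrite (Rintegral_split ar rs (integrable_sub (lexx a) sb hg)).
  by rewrite addrC addKr.
have Xsr : X s - X r = \int[mu]_(x in `[r, s]) f x.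
  by rewrite (hX s) ?as_// (hX r) ?ar// opprD addrACA subrr add0r spl.
have msr : m s - m r = \int[mu]_(x in `[r, s]) m' x.
  by rewrite (Rintegral_C1 rs (C1_sub ar sb hm) (within_sub ar sb cm')).
have Nsr : N s - N r = \int[mu]_(x in `[r, s]) `|f x| by exact: spl.
have N0 : 0 <= N s - N r by rewrite Nsr Rintegral_ge0.
have Xst t : t \in `[r, s] -> `|X s - X t| <= N s - N r.
  rewrite in_itv/= => /andP[rt ts].
  have at_ := le_trans ar rt; have tb := le_trans ts sb.
  rewrite (hX s) ?as_// (hX t) ?at_// opprD addrACA subrr add0r.
  have ht := integrable_sub at_ sb hf.
  have htn := integrable_sub at_ sb hfn.
  rewrite (Rintegral_split at_ ts (integrable_sub (lexx a) sb hf)) [X in `|X|]addrC addKr.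
  rewrite (le_trans (le_normr_Rintegral _ _))// Nsr (Rintegral_split rt ts (sub _ hfn)).
  by rewrite lerDr Rintegral_ge0.
have mrt t : t \in `[r, s] -> `|m r - m t| <= C * (s - r).
  rewrite in_itv/= => /andP[rt ts].
  have at_ := le_trans ar rt; have tb := le_trans ts sb.
  rewrite distrC.
  have hi : mu.-integrable `[r, t] (EFin \o m').
    by apply: cont_integrable; apply: within_sub cm'.
  rewrite -(Rintegral_C1 rt (C1_sub ar tb hm) (within_sub ar tb cm')).
  rewrite (le_trans (le_normr_Rintegral _ _))//.
  apply: (@le_trans _ _ (\int[mu]_(x in `[r, t]) C)).
    apply: le_Rintegral => //; first exact: integrable_norm.
      by apply: cont_integrable => x; exact: cvg_cst.
    move=> x /=; rewrite in_itv/= => /andP[rx xt]; apply: mC.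
    by rewrite (le_trans ar rx) (le_trans xt tb).
  by rewrite Rintegral_cst// ler_wpM2l// lerD2r.
(* Freezing [X] at [s] and [m] at [r] writes the defect as one integral. In each term one factor is
   an increment over the interval: [m'] times at most [N s - N r], and [f] times at most
   [C (s - r)]. Both integrate to at most [C (s - r) (N s - N r)]. *)
have EE : E s - E r = \int[mu]_(t in `[r, s]) (m' t * (X s - X t) + (m r - m t) * f t).
  have -> : E s - E r = (m s - m r) * X s + m r * (X s - X r)
      - \int[mu]_(t in `[r, s]) (m' t * X t + m t * f t).
    rewrite -spl// /E; ring.
  rewrite msr Xsr -RintegralZr//; last exact: sub (cont_integrable cm').
  rewrite -RintegralZl//; last exact: sub.
  have j1 : mu.-integrable `[r, s] (EFin \o (fun t => m' t * X s)).
    apply: cont_integrable; apply: withinM; first exact: within_sub cm'.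
    by move=> x; exact: cvg_cst.
  have j2 : mu.-integrable `[r, s] (EFin \o (fun t => m r * f t)).
    by apply: integrable_scale => //; exact: sub.
  rewrite -RintegralD// -RintegralB//; last 2 first.
  - exact: integrable_addr.
  - exact: sub.
  by apply: eq_Rintegral => t _; ring.
have j3 : mu.-integrable `[r, s] (EFin \o (fun t => m' t * (X s - X t) + (m r - m t) * f t)).
  apply: integrable_addr => //.
  - apply: cont_integrable; apply: withinM; first exact: within_sub cm'.
    move=> x; apply: cvgB; first exact: cvg_cst.
    by apply: (within_sub ar sb cX).
  - apply: integrable_cont_mul; last exact: sub.
    move=> x; apply: cvgB; first exact: cvg_cst.
    by apply: (within_sub ar sb cm).
rewrite EE (le_trans (le_normr_Rintegral _ j3))//.
have hc : mu.-integrable `[r, s] (EFin \o (fun t : R => C * (N s - N r))).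
  by apply: cont_integrable => x; exact: cvg_cst.
have hd : mu.-integrable `[r, s] (EFin \o (fun t : R => C * (s - r) * `|f t|)).
  by apply: integrable_scale => //; exact: sub.
apply: (@le_trans _ _ (\int[mu]_(t in `[r, s]) (C * (N s - N r) + C * (s - r) * `|f t|))).
  apply: le_Rintegral => //.
  - exact: integrable_norm.
  - exact: integrable_addr.
  move=> t /= trs; have tI : t \in `[r, s] by [].
  rewrite (le_trans (ler_normD _ _))// !normrM lerD//.
    apply: ler_pM => //; last exact: Xst.
    move: tI; rewrite in_itv/= => /andP[rt ts]; apply: mC.
    by rewrite (le_trans ar rt) (le_trans ts sb).
  by apply: ler_wpM2r => //; exact: mrt.
rewrite (RintegralD _ hc hd)// (RintegralZl _ _ (sub _ hfn))//.
by rewrite -Nsr Rintegral_cst// le_eqVlt; apply/orP; left; apply/eqP; ring.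
Unshelve. all: by end_near. Qed.

End ScalarIntegral.

(** * Integrals of matrix-valued functions *)

Section MatrixIntegral.
Variable R : realType.
Notation mu := (@lebesgue_measure R).
Implicit Types (a b c t : R).

Definition mint m n a b (F : R -> 'M[R]_(m, n)) :=
  forall i j, mu.-integrable `[a, b] (EFin \o (fun t => F t i j)).

Lemma mint_sub m n a b c d (F : R -> 'M[R]_(m, n)) : a <= c -> d <= b ->
  mint a b F -> mint c d F.
Proof. by move=> ac db hF i j; apply: integrable_sub (hF i j). Qed.

Lemma mint_cont m n a b (F : R -> 'M[R]_(m, n)) : mcont a b F -> mint a b F.
Proof. by move=> cF i j; apply: cont_integrable; exact: cF. Qed.

Lemma mint_eq m n a b (F G : R -> 'M[R]_(m, n)) :
  (forall t, a <= t <= b -> F t = G t) -> mint a b F -> mint a b G.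
Proof.
move=> e hF i j; apply: eq_integrable (hF i j) => // t; rewrite inE/= in_itv/= => tab.
by rewrite e.
Qed.

Lemma mxint_eq m n a b (F G : R -> 'M[R]_(m, n)) :
  (forall t, a <= t <= b -> F t = G t) -> mxint a b F = mxint a b G.
Proof.
move=> e; apply/matrixP => i j; rewrite !mxE; apply: eq_Rintegral => t.
by rewrite inE/= in_itv/= => tab; rewrite e.
Qed.

Lemma mxintD m n a b (F G : R -> 'M[R]_(m, n)) : mint a b F -> mint a b G ->
  mxint a b (fun t => F t + G t) = mxint a b F + mxint a b G.
Proof.
move=> hF hG; apply/matrixP => i j; rewrite !mxE -RintegralD//.
by apply: eq_Rintegral => t _; rewrite mxE.
Qed.

Lemma mxint_split m n a b c (F : R -> 'M[R]_(m, n)) : a <= c -> c <= b ->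
  mint a b F -> mxint a b F = mxint a c F + mxint c b F.
Proof.
move=> ac cb hF; apply/matrixP => i j; rewrite !mxE; exact: Rintegral_split.
Qed.

Lemma mxint_refl m n a (F : R -> 'M[R]_(m, n)) : mxint a a F = 0.
Proof. by apply/matrixP => i j; rewrite !mxE set_itv1 Rintegral_set1. Qed.

Lemma mxint_tr m n a b (F : R -> 'M[R]_(m, n)) :
  (mxint a b F)^T = mxint a b (fun t => (F t)^T).
Proof.
by apply/matrixP => i j; rewrite !mxE; apply: eq_Rintegral => t _; rewrite mxE.
Qed.

Lemma mC1_mxint m n a b (F : R -> 'M[R]_(m, n)) : a <= b -> mcont a b F ->
  mC1 a b (fun t => mxint a t F) F.
Proof.
move=> ab cF; split => [i j|t tab i j].
  rewrite (_ : (fun t => _) = (fun t => \int[mu]_(x in `[a, t]) F x i j)); last first.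
    by apply/funext => t; rewrite mxE.
  by have [] := C1_Rintegral ab (cF i j).
rewrite (_ : (fun t => _) = (fun t => \int[mu]_(x in `[a, t]) F x i j)); last first.
  by apply/funext => s; rewrite mxE.
by have [_] := C1_Rintegral ab (cF i j); exact.
Qed.

(** The form needed below: a classical multiplier [M], built from an evolution operator, against a
    Caratheodory solution [X]. *)
Lemma mxint_by_parts m n p a b (M M' : R -> 'M[R]_(m, n)) (X F : R -> 'M[R]_(n, p)) :
  a <= b -> mC1 a b M M' -> mcont a b M' -> mint a b F ->
  (forall t, a <= t <= b -> X t = X a + mxint a t F) ->
  mint a b (fun t => M' t *m X t + M t *m F t) /\
  mxint a b (fun t => M' t *m X t + M t *m F t) = M b *m X b - M a *m X a.
Proof.
move=> ab hM cM' hF hX.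
have E i j t : (M' t *m X t + M t *m F t) i j =
    \sum_k (M' t i k * X t k j + M t i k * F t k j).
  by rewrite !mxE -big_split.
have H i j k := by_parts_abs_cont ab (mC1_entry i k hM) (cM' i k) (hF k j)
  (X := fun t => X t k j).
have HX k j t : a <= t <= b -> X t k j = X a k j + \int[mu]_(x in `[a, t]) F x k j.
  by move=> /hX ->; rewrite !mxE.
split => [i j|].
  rewrite (_ : (fun t => _) = (fun t => \sum_k (M' t i k * X t k j + M t i k * F t k j))).
    by apply: (Rintegral_sum _ _).1 => // k; apply: (H i j k (HX k j)).1.
  by apply/funext => t; rewrite E.
apply/matrixP => i j; rewrite mxE.
under eq_Rintegral do rewrite E.
rewrite (Rintegral_sum _ _).2//; last by move=> k; apply: (H i j k (HX k j)).1.
rewrite !mxE -sumrB; apply: eq_bigr => k _; exact: (H i j k (HX k j)).2.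
Qed.

Lemma mxint_dot n a b (F : R -> 'cV[R]_n) y : mint a b F ->
  mu.-integrable `[a, b] (EFin \o (fun t => dot y (F t))) /\
  dot y (mxint a b F) = \int[mu]_(t in `[a, b]) dot y (F t).
Proof.
move=> hF.
have e : (fun t => dot y (F t)) = (fun t => \sum_i y i 0 * F t i 0).
  by apply/funext => t; rewrite dotE.
rewrite e.
have hi i : mu.-integrable `[a, b] (EFin \o (fun t => y i 0 * F t i 0)).
  exact: integrable_scale (hF i 0).
have [h1 h2] := Rintegral_sum (measurable_itv _) hi.
split => //; rewrite h2 dotE; apply: eq_bigr => i _.
by rewrite mxE RintegralZl//; exact: hF.
Qed.

(** The integral is entrywise, so the Euclidean norm is reached by pairing with a fixed vector,
    which commutes with the integral. *)
Lemma enorm_mxint_le n a b (F : R -> 'cV[R]_n) (g : R -> R) : mint a b F ->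
  mu.-integrable `[a, b] (EFin \o g) ->
  (forall t, a <= t <= b -> enorm (F t) <= g t) ->
  enorm (mxint a b F) <= \int[mu]_(t in `[a, b]) g t.
Proof.
move=> hF hg Fg.
have tI t : `[a, b]%classic t -> a <= t <= b by rewrite /= in_itv.
apply: enorm_le_dot => [|y].
  apply: Rintegral_ge0 => t /tI tab; apply: le_trans (Fg t tab); exact: enorm_ge0.
have [h1 ->] := mxint_dot y hF.
rewrite -RintegralZl//; apply: le_Rintegral => //; first exact: integrable_scale.
move=> t /tI tab; rewrite (le_trans (cauchy_schwarz _ _))// ler_wpM2l ?enorm_ge0//.
exact: Fg.
Qed.

(** Made for integrands that carry the effect of the Dirac term on the adjoint, which stops at the
    time of the atom. *)
Lemma mxint_cut m n a b c (F : R -> 'M[R]_(m, n)) : a <= c -> a <= b -> mint a b F ->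
  mint a b (fun s => if s <= c then F s else 0) /\
  mxint a b (fun s => if s <= c then F s else 0) = mxint a (Num.min b c) F.
Proof.
move=> ac ab hF.
have e i j : (fun s => (if s <= c then F s else 0) i j) = (fun s => F s i j) \_ `]-oo, c].
  apply/funext => s; rewrite patchE; have -> : (s \in `]-oo, c]%classic) = (s <= c).
    by apply/idP/idP; rewrite inE /= in_itv.
  by case: ifP => // _; rewrite mxE.
have I : `[a, b]%classic `&` `]-oo, c]%classic = `[a, Num.min b c]%classic :> set R.
  apply/seteqP; split => s /=; rewrite !in_itv/= le_min.
    by move=> [/andP[-> ->] ->].
  by move=> /and3P[-> -> ->].
split => [i j|].
  rewrite e -restrict_EFin; apply/integrable_restrict => //.
  rewrite I; apply: (integrable_sub (lexx a) _ (hF i j)).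
  by rewrite ge_min lexx.
by apply/matrixP => i j; rewrite !mxE e -Rintegral_mkcondr I.
Qed.

Lemma solves_ode_ae_from m n T (X F : R -> 'M[R]_(m, n)) a t : solves_ode_ae T X F ->
  0 <= a -> a <= t -> t <= T -> X t = X a + mxint a t F.
Proof.
move=> [hF hX] a0 at_ tT.
have hF' : mint 0 T F by move=> i j; exact: hF.
rewrite (hX t) ?in_itv/= ?tT ?(le_trans a0)//.
rewrite (hX a) ?in_itv/= ?a0 ?(le_trans at_)//.
by rewrite -addrA -mxint_split//; exact: mint_sub hF'.
Qed.

End MatrixIntegral.

(** * The constants *)

Section Constants.
Variables (R : realType) (k : lq_consts R).
Hypothesis hk : consts_pos k.

Lemma lamA_gt0 : 0 < lamA k. Proof. by case: hk => _ [[]]. Qed.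
Lemma lamB_gt0 : 0 < lamB k. Proof. by case: hk => _ [[]]. Qed.
Lemma lamC_gt0 : 0 < lamC k. Proof. by case: hk => _ [[]]. Qed.
Lemma lamQ_gt0 : 0 < lamQ k. Proof. by case: hk => _ [[]]. Qed.
Lemma lamH_gt0 : 0 < lamH k. Proof. by case: hk => _ [_ [[]]]. Qed.
Lemma lamR_gt0 : 0 < lamR k. Proof. by case: hk => _ [_ [[]]]. Qed.
Lemma lamG_gt0 : 0 < lamG k. Proof. by case: hk => _ [_ [[]]]. Qed.
Lemma lamW_gt0 : 0 < lamW k. Proof. by case: hk => _ [_ [[]]]. Qed.
Lemma gamR_gt0 : 0 < gamR k. Proof. by case: hk => _ [_ [_ []]]. Qed.
Lemma gamQ_gt0 : 0 < gamQ k. Proof. by case: hk => _ [_ [_ [_ []]]]. Qed.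
Lemma alpha0_gt0 : 0 < alpha0 k. Proof. by case: hk => _ [_ [_ [_ [_ []]]]]. Qed.
Lemma alpha1_gt0 : 0 < alpha1 k. Proof. by case: hk => _ [_ [_ [_ [_ []]]]]. Qed.
Lemma sigma_gt0 : 0 < sigma k. Proof. by case: hk. Qed.

Lemma lamA_lt_kappa : lamA k < kappa k.
Proof. by rewrite /kappa ltrDl divr_gt0 ?mulr_gt0 ?lamB_gt0 ?lamH_gt0 ?gamR_gt0. Qed.

Lemma kappa_gt0 : 0 < kappa k.
Proof. exact: lt_trans lamA_gt0 lamA_lt_kappa. Qed.

Local Notation E := (expR (2 * kappa k * sigma k)).

Lemma expR_kappa_gt1 : 1 < E.
Proof. by rewrite expR_gt1 !mulr_gt0 ?kappa_gt0 ?sigma_gt0. Qed.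

(** With [e] for the exponential, [(e - 1) / (1 - 1 / e) = e]; this turns [c0] into an expression in
    [e] alone. *)
Lemma talpha_ratio : talpha1 k / talpha0 k = E.
Proof.
rewrite /talpha1 /talpha0 expRN.
have e1 := expR_kappa_gt1; have k0 := kappa_gt0; set e := E in e1 *.
field; rewrite ?(gt_eqF k0)/=.
by apply/andP; split; apply/negP => /eqP; lra.
Qed.

Lemma talpha0_gt0 : 0 < talpha0 k.
Proof.
rewrite /talpha0 expRN divr_gt0 ?mulr_gt0 ?kappa_gt0// subr_gt0.
by rewrite invf_lt1 ?expR_kappa_gt1// (lt_trans ltr01 expR_kappa_gt1).
Qed.

Lemma c0_gt0 : 0 < c0 k.
Proof.
have h0 := kappa_gt0; have hB := lamB_gt0; have hR := gamR_gt0; have hQ := gamQ_gt0.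
have h1 := talpha0_gt0.
rewrite /c0 mulr_gt0 ?expR_gt0// lt_min; apply/andP; split.
  rewrite mulr_gt0 ?mulr_gt0// invr_gt0 addr_gt0//.
    rewrite mulr_gt0 ?divr_gt0 ?exprn_gt0// talpha_ratio.
    by have := expR_kappa_gt1; lra.
  by rewrite divr_gt0// mulr_gt0// exprn_gt0.
by rewrite invr_gt0 addr_gt0 ?divr_gt0 ?mulr_gt0 ?exprn_gt0.
Qed.

Lemma inv_add_le (a b : R) : 0 < a -> 0 < b -> (a + b)^-1 <= b^-1.
Proof. by move=> a0 b0; rewrite lef_pV2 ?posrE ?addr_gt0// lerDr ltW. Qed.

(** Comes from the second entry of the minimum; it settles the terminal time, where [S T = Q_T]
    dominates [gamQ]. *)
Lemma c0_le_gamQ : c0 k <= gamQ k.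
Proof.
have h0 := kappa_gt0; have hB := lamB_gt0; have hR := gamR_gt0; have hQ := gamQ_gt0.
rewrite /c0 -[leRHS]mulr1; apply: ler_pM.
- by have := c0_gt0; rewrite /c0 pmulr_lgt0 ?expR_gt0// => /ltW.
- exact: expR_ge0.
- rewrite ge_min; apply/orP; right.
  by rewrite (le_trans (inv_add_le _ _)) ?div1r ?invrK ?divr_gt0 ?mulr_gt0 ?exprn_gt0 ?invr_gt0.
- by rewrite expRN invf_le1 ?expR_gt0// ltW// expR_kappa_gt1.
Qed.

(** This makes the constant matrix [c0 I] a subsolution of the Riccati equation. Both estimates use
    the first entry of the minimum, an inverse of a sum of two terms: dropping either term gives a
    bound. The outcome is at most [gamQ / 4 + gamQ / 16]. *)
Lemma c0_riccati : 2 * kappa k * c0 k + lamB k ^+ 2 / gamR k * c0 k ^+ 2 <= gamQ k.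
Proof.
have h0 := kappa_gt0; have hB := lamB_gt0; have hR := gamR_gt0; have hQ := gamQ_gt0.
have h1 := talpha0_gt0; have c0p := c0_gt0.
set beta := lamB k ^+ 2 / gamR k.
have bp : 0 < beta by rewrite divr_gt0 ?exprn_gt0.
have e1 := expR_kappa_gt1.
have hX : c0 k <= 2 * kappa k *
     (beta * (1 + E) ^+ 2 + 1 / (gamQ k * talpha0 k ^+ 2))^-1 / E.
  by rewrite /c0 talpha_ratio expRN ler_wpM2r ?invr_ge0 ?expR_ge0// ge_min lexx.
have t0E : talpha0 k = (1 - E^-1) / (2 * kappa k) by rewrite /talpha0 expRN.
move: (c0 k) c0p hX t0E => c cp hX t0E; set e := E in e1 hX t0E *.
have ep : 0 < e by lra.
have bE : 0 < beta * (1 + e) ^+ 2 by rewrite mulr_gt0// exprn_gt0//; lra.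
have gE : 0 < 1 / (gamQ k * talpha0 k ^+ 2).
  by rewrite divr_gt0// mulr_gt0// exprn_gt0.
have k2 : 0 < 2 * kappa k by rewrite mulr_gt0.
pose q := e^-1.
have q01 : 0 < q < 1 by rewrite invr_gt0 ep invf_lt1.
(* Keeping only the term in [gamQ]: with [q = 1 / e] there remains [gamQ (1 - q)^2 q], and
   [(1 - q)^2 q <= 1 / 4] on the unit interval. *)
have hc1 : 2 * kappa k * c <= gamQ k / 4.
  have : c <= 2 * kappa k * (1 / (gamQ k * talpha0 k ^+ 2))^-1 * q.
    apply: (le_trans hX); rewrite ler_wpM2r ?invr_ge0 ?(ltW ep)//.
    by rewrite ler_wpM2l ?(ltW k2)// inv_add_le.
  rewrite div1r invrK t0E -/q => h; have {h} := ler_wpM2l (ltW k2) h.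
  have -> : 2 * kappa k * (2 * kappa k * (gamQ k * ((1 - q) / (2 * kappa k)) ^+ 2) * q) =
      gamQ k * ((1 - q) ^+ 2 * q).
    by field; rewrite gt_eqF.
  move/le_trans; apply; rewrite ler_pM2l//.
  have : 0 <= (q - 1/2) ^+ 2 by rewrite sqr_ge0.
  case/andP: q01 => q0 q1; nra.
(* Keeping only the term in [beta]: there remains [2 kappa / ((1 + e)^2 e)] with [e > 1]. *)
have hc2 : beta * c <= 2 * kappa k / 4.
  have : c <= 2 * kappa k * (beta * (1 + e) ^+ 2)^-1 * q.
    apply: (le_trans hX); rewrite ler_wpM2r ?invr_ge0 ?(ltW ep)//.
    by rewrite ler_wpM2l ?(ltW k2)// addrC inv_add_le.
  move=> h; have {h} := ler_wpM2l (ltW bp) h.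
  have -> : beta * (2 * kappa k * (beta * (1 + e) ^+ 2)^-1 * q) =
     2 * kappa k * ((1 + e) ^+ 2 * e)^-1.
    rewrite /q; field; rewrite (gt_eqF ep) (gt_eqF bp) /= andbT.
    by apply/negP => /eqP; lra.
  move/le_trans; apply; rewrite ler_pM2l//.
  have e2 : 0 < (1 + e) ^+ 2 by rewrite exprn_gt0//; lra.
  rewrite lef_pV2 ?posrE ?(mulr_gt0 e2 ep)//.
  by nra.
have := ler_wpM2r (ltW cp) hc2; nra.
Qed.

Lemma alpha1'_gt0 : 0 < alpha1' k.
Proof.
rewrite /alpha1' divr_gt0 ?mulr_gt0 ?exprn_gt0 ?lamB_gt0 ?kappa_gt0//.
by rewrite subr_gt0 expR_kappa_gt1.
Qed.

Lemma alpha0'_gap_ge0 : 0 <= lamH k ^+ 2 / (gamR k ^+ 2 * lamA k) * (1 + alpha1 k / alpha0 k) ^+ 2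
     * (expR (2 * lamA k * sigma k) - 1).
Proof.
have := lamH_gt0; have := gamR_gt0; have := lamA_gt0; have := sigma_gt0 => ? ? ? ?.
have e : 0 < expR (2 * lamA k * sigma k) - 1 by rewrite subr_gt0 expR_gt1 !mulr_gt0.
by rewrite mulr_ge0 ?(ltW e)// mulr_ge0 ?sqr_ge0// divr_ge0 ?sqr_ge0// mulr_ge0 ?sqr_ge0// ltW.
Qed.

Lemma alpha0'_gt0 : 0 < alpha0' k.
Proof.
by rewrite invr_gt0 ltr_wpDr ?alpha0'_gap_ge0// divr_gt0// alpha0_gt0.
Qed.

Lemma alpha0'_le : alpha0' k <= alpha0 k / 2.
Proof.
have a0 := alpha0_gt0.
rewrite -[leRHS]invrK lef_pV2 ?posrE ?invr_gt0 ?divr_gt0//; last first.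
  by rewrite ltr_wpDr ?alpha0'_gap_ge0// divr_gt0// alpha0_gt0.
by rewrite invf_div lerDl alpha0'_gap_ge0.
Qed.

Lemma lamQH_gt0 : 0 < lamQ k + lamH k ^+ 2 / gamR k.
Proof. by rewrite addr_gt0 ?lamQ_gt0// divr_gt0 ?exprn_gt0 ?lamH_gt0 ?gamR_gt0. Qed.

(** The left side is the cost bound for zero control over a time at most [sigma]: the terminal
    weight after growth, plus the integrated running cost. The second entry of the maximum covers
    it. *)
Lemma c1_ge_tail : lamQ k * E + lamQ k * ((E - 1) / (2 * kappa k)) <= c1 k.
Proof.
have h0 := kappa_gt0; have hQ := lamQ_gt0; have hQH := lamQH_gt0.
have e1 := expR_kappa_gt1; set e := E in e1 *.
apply: (@le_trans _ _ ((lamQ k + lamH k ^+ 2 / gamR k) * (1 + 1 / (2 * kappa k)) * e)); last first.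
  by rewrite /c1 ler_wpM2r ?expR_ge0// le_max lexx orbT.
apply: (@le_trans _ _ (lamQ k * (1 + 1 / (2 * kappa k)) * e)); last first.
  rewrite ler_wpM2r//; first by lra.
  rewrite ler_wpM2r ?addr_ge0 ?divr_ge0 ?mulr_ge0 ?(ltW h0)//.
  by rewrite lerDl divr_ge0 ?sqr_ge0// ltW// gamR_gt0.
have i0 : 0 < (2 * kappa k)^-1 by rewrite invr_gt0 mulr_gt0.
have := mulr_gt0 hQ i0; move: (2 * kappa k)^-1 => i; lra.
Qed.

Lemma c1_gt0 : 0 < c1 k.
Proof.
apply: lt_le_trans c1_ge_tail; have e1 := expR_kappa_gt1.
rewrite addr_gt0 ?mulr_gt0 ?lamQ_gt0 ?expR_gt0 ?invr_gt0 ?mulr_gt0 ?kappa_gt0//.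
by rewrite subr_gt0.
Qed.

(** The left side is the cost bound for the Gramian control: [lamR / alpha0'] for the control
    together with the cross term, then the state. The first entry of the maximum covers it. *)
Lemma c1_ge_steer : alpha0 k <= alpha1' k ->
  lamR k / alpha0' k + lamQ k * (1 + alpha1' k / alpha0 k) ^+ 2 * ((E - 1) / (2 * kappa k)) <= c1 k.
Proof.
move=> a01.
have h0 := kappa_gt0; have hQ := lamQ_gt0; have hQH := lamQH_gt0.
have a0p := alpha0_gt0; have a0'p := alpha0'_gt0; have a0'le := alpha0'_le.
have a1'p := alpha1'_gt0; have hR := lamR_gt0; have hB := lamB_gt0.
have a1'E : alpha1' k = lamB k ^+ 2 * (E - 1) / (2 * kappa k) by [].
have e1 := expR_kappa_gt1.
apply: (@le_trans _ _ (1 / (2 * kappa k) *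
     ((lamQ k + lamH k ^+ 2 / gamR k) * (1 + alpha1' k / alpha0' k) ^+ 2
      + lamR k * lamB k ^+ 2 / alpha0' k ^+ 2) * E)); last first.
  by rewrite /c1 ler_wpM2r ?expR_ge0// le_max lexx.
move: (alpha0' k) (alpha1' k) (alpha0 k) a01 a0p a0'p a0'le a1'p a1'E => a0' a1' a0 a01 a0p a0'p a0'le a1'p a1'E.
set e := E in e1 a1'E *.
have k2 : 0 < 2 * kappa k by rewrite mulr_gt0.
have ep : 0 < e by lra.
rewrite [leRHS](_ : _ = (lamR k * lamB k ^+ 2 / a0' ^+ 2) * (e / (2 * kappa k)) +
    (lamQ k + lamH k ^+ 2 / gamR k) * (1 + a1' / a0') ^+ 2 * (e / (2 * kappa k))); last by ring.
apply: lerD.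
(* The excess factor is at least [alpha1' / alpha0'], which is at least 1 because
   [alpha0' <= alpha0 / 2] and [alpha0 <= alpha1']. *)
- have -> : lamR k * lamB k ^+ 2 / a0' ^+ 2 * (e / (2 * kappa k)) =
     lamR k / a0' * (lamB k ^+ 2 * e / (2 * kappa k) / a0').
    by field; rewrite (gt_eqF h0) (gt_eqF a0'p).
  rewrite ler_pMr ?divr_gt0// ler_pdivlMr// mul1r.
  have : a1' <= lamB k ^+ 2 * e / (2 * kappa k).
    rewrite a1'E ler_pM2r ?invr_gt0// ler_pM2l ?exprn_gt0//; lra.
  lra.
- have r0 : 0 <= a1' / a0 by apply: divr_ge0; exact: ltW.
  have r1 : a1' / a0 <= a1' / a0'.
    rewrite ler_pM2l// lef_pV2 ?posrE//; lra.
  apply: ler_pM.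
  + by apply: mulr_ge0; [exact: ltW|exact: sqr_ge0].
  + by rewrite divr_ge0 ?(ltW k2)//; lra.
  + apply: ler_pM; rewrite ?sqr_ge0 ?(ltW hQ)//.
      by rewrite lerDl divr_ge0 ?sqr_ge0// ltW// gamR_gt0.
    rewrite ler_pXn2r ?nnegrE//; lra.
  + by rewrite ler_pM2r ?invr_gt0//; lra.
Qed.

Lemma cZ_ge0 : 0 <= cZ k. Proof. exact: sqrtr_ge0. Qed.

Lemma cZ_gt0 : 0 < cZ k.
Proof. by rewrite sqrtr_gt0 divr_gt0 ?c1_gt0 ?c0_gt0. Qed.

Lemma rhoZ_gt0 : 0 < rhoZ k.
Proof. by rewrite divr_gt0 ?gamQ_gt0// mulr_gt0// c1_gt0. Qed.

Lemma cv_gt0 : 0 < cv k.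
Proof.
have cZp := cZ_gt0; have c1p := c1_gt0; have hB := lamB_gt0; have hC := lamC_gt0.
have hH := lamH_gt0; have hG := lamG_gt0; have hW := lamW_gt0; have hR := gamR_gt0.
rewrite /cv; move: (cZ k) (c1 k) cZp c1p => z c zp cp.
by rewrite !(addr_gt0, mulr_gt0, divr_gt0, invr_gt0).
Qed.

Lemma Lambda_x_gt0 : 0 < Lambda_x k.
Proof.
have cZp := cZ_gt0; have c1p := c1_gt0; have hB := lamB_gt0; have hC := lamC_gt0.
have hH := lamH_gt0; have hG := lamG_gt0; have hW := lamW_gt0; have hR := gamR_gt0.
have cvp := cv_gt0; have rp := rhoZ_gt0.
rewrite /Lambda_x; move: (cZ k) (cv k) (rhoZ k) cZp cvp rp => z c r zp cp rp.
by rewrite !(addr_gt0, mulr_gt0, exprn_gt0, invr_gt0).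
Qed.

Lemma Lambda_gt0 : 0 < Lambda k.
Proof.
have cZp := cZ_gt0; have c1p := c1_gt0; have hB := lamB_gt0; have hC := lamC_gt0.
have hH := lamH_gt0; have hG := lamG_gt0; have hW := lamW_gt0; have hR := gamR_gt0.
have cvp := cv_gt0; have lp := Lambda_x_gt0.
rewrite /Lambda; move: (cv k) (c1 k) (Lambda_x k) cvp c1p lp => v c l vp cp lp.
by rewrite !(addr_gt0, mulr_gt0, invr_gt0).
Qed.

End Constants.

(** * The Riccati solution *)

Lemma addmxE (R : realType) m n (M N : 'M[R]_(m, n)) i j : (M + N) i j = M i j + N i j.
Proof. by rewrite mxE. Qed.

Lemma oppmxE (R : realType) m n (M : 'M[R]_(m, n)) i j : (- M) i j = - M i j.
Proof. by rewrite mxE. Qed.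

Lemma trmxD (R : realType) m n (M N : 'M[R]_(m, n)) : (M + N)^T = M^T + N^T.
Proof. exact: linearD. Qed.

Lemma trmxN (R : realType) m n (M : 'M[R]_(m, n)) : (- M)^T = - M^T.
Proof. exact: linearN. Qed.

Lemma zeromxE (R : realType) m n i j : (0 : 'M[R]_(m, n)) i j = 0.
Proof. by rewrite mxE. Qed.

(* Expands both sides into sums of monomials; entrywise these are atoms for [ring]. *)
Ltac mxring :=
  rewrite ?(mulmxDl, mulmxDr, mulNmx, mulmxN, mulmxA, mulmx1, mul1mx, mulmx0, mul0mx);
  let i := fresh in let j := fresh in
  apply/matrixP => i j; rewrite ?(addmxE, oppmxE, zeromxE); ring.

Lemma mC1_const (R : realType) m n (a b : R) (X X' : R -> 'M[R]_(m, n)) : a <= b ->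
  mC1 a b X X' -> (forall t, a < t < b -> X' t = 0) -> X b = X a.
Proof.
move=> ab hX X0; apply/matrixP => i j.
have h := mC1_entry i j hX.
apply/le_anti/andP; split.
  have := C1_le (C1Z (-1) h); rewrite !mulN1r lerN2; apply=> // t tab.
  by rewrite X0// mxE mulr0.
by apply: (C1_le h) => // t tab; rewrite X0// mxE.
Qed.

Lemma expR_sqr (R : realType) (c r : R) : expR (2 * c * r) = expR (c * r) ^+ 2.
Proof. by rewrite -mulrA expRM_natl. Qed.

Section LQ.
Variables (R : realType) (k : lq_consts R) (nx nu nd : nat) (T : R).
Variables (p : lq_data R nx nu nd) (S : R -> 'M[R]_nx) (PhiZ : R -> R -> 'M[R]_nx).
Hypothesis hk : consts_pos k.
Hypothesis hsym : lq_symmetric T p.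
Hypothesis hA1 : assumption_A1 T p k.
Hypothesis hA3 : assumption_A3 T p k.
Hypothesis hS : riccati_solution T p S.
Hypothesis hPhiZ : is_evolution T (Zmat p S) PhiZ.

Local Notation A := (fA p).
Local Notation B := (fB p).
Local Notation Q := (fQ p).
Local Notation H := (fH p).
Local Notation Ri t := (invmx (fR p t)).

(** Writing [u = w - R^-1 H x] removes the cross term of the cost: the drift becomes [feedback] and
    the state weight the Schur complement [schurQ]. *)
Definition feedback t : 'M[R]_nx := A t - B t *m Ri t *m H t.
Definition ctrlmx t : 'M[R]_nx := B t *m Ri t *m (B t)^T.
Definition schurQ t : 'M[R]_nx := Q t - (H t)^T *m Ri t *m H t.

Lemma A_bound t : t \in `[0, T] -> opbound (A t) (lamA k).
Proof. by case: hA1 => _ [h _ _ _ _]; exact: supnorm_opbound. Qed.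
Lemma B_bound t : t \in `[0, T] -> opbound (B t) (lamB k).
Proof. by case: hA1 => _ [_ h _ _ _]; exact: supnorm_opbound. Qed.
Lemma Q_bound t : t \in `[0, T] -> opbound (Q t) (lamQ k).
Proof. by case: hA1 => _ [_ _ h _ _]; exact: supnorm_opbound. Qed.
Lemma H_bound t : t \in `[0, T] -> opbound (H t) (lamH k).
Proof. by case: hA1 => _ [_ _ _ h _]; exact: supnorm_opbound. Qed.
Lemma R_bound t : t \in `[0, T] -> opbound (fR p t) (lamR k).
Proof. by case: hA1 => _ [_ _ _ _ h]; exact: supnorm_opbound. Qed.
Lemma BT_bound t : t \in `[0, T] -> opbound (B t)^T (lamB k).
Proof. by move=> tT; apply: opbound_tr (B_bound tT); exact/ltW/(lamB_gt0 hk). Qed.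

Lemma A_cont : mcont 0 T A.
Proof. by case: hA1 => -[h _ _ _ _] _; exact: mcont_within. Qed.
Lemma B_cont : mcont 0 T B.
Proof. by case: hA1 => -[_ h _ _ _] _; exact: mcont_within. Qed.
Lemma Q_cont : mcont 0 T Q.
Proof. by case: hA1 => -[_ _ h _ _] _; exact: mcont_within. Qed.
Lemma H_cont : mcont 0 T H.
Proof. by case: hA1 => -[_ _ _ h _] _; exact: mcont_within. Qed.
Lemma R_cont : mcont 0 T (fR p).
Proof. by case: hA1 => -[_ _ _ _ h] _; exact: mcont_within. Qed.

Lemma R_coercive t x : t \in `[0, T] -> gamR k * enorm x ^+ 2 <= dot x (fR p t *m x).
Proof.
by move=> tT; rewrite -dot_scalar_mx; apply: loewner_leE; case: hA3 => h _ _ _; exact: h.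
Qed.

Lemma R_unit t : t \in `[0, T] -> fR p t \in unitmx.
Proof. by move=> tT; apply: (coercive_unit (gamR_gt0 hk)) => x; exact: R_coercive. Qed.

Lemma Ri_ge0 t x : t \in `[0, T] -> 0 <= dot x (Ri t *m x).
Proof. by move=> tT; apply: (coercive_inv_dot (gamR_gt0 hk)) => y; exact: R_coercive. Qed.

Lemma Ri_bound t : t \in `[0, T] -> opbound (Ri t) (gamR k)^-1.
Proof. by move=> tT; apply: (coercive_inv_opbound (gamR_gt0 hk)) => y; exact: R_coercive. Qed.

Lemma Ri_sym t : t \in `[0, T] -> (Ri t)^T = Ri t.
Proof. by move=> tT; apply: trmx_inv_sym; case: hsym => /(_ t tT) []. Qed.

Lemma Q_sym t : t \in `[0, T] -> (Q t)^T = Q t.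
Proof. by move=> tT; case: hsym => /(_ t tT) []. Qed.

Lemma Ri_cont : mcont 0 T (fun t => Ri t).
Proof.
apply: (@mcont_inv _ _ _ _ _ _ (gamR k)^-1 R_cont) => t tT; last first.
  by move=> i j; exact: opbound_entry (Ri_bound tT).
by rewrite mulVmx// R_unit.
Qed.

Lemma feedback_cont : mcont 0 T feedback.
Proof.
apply: mcontB; first exact: A_cont.
by apply: mcontM; [apply: mcontM; [exact: B_cont|exact: Ri_cont]|exact: H_cont].
Qed.

Lemma ctrlmx_cont : mcont 0 T ctrlmx.
Proof.
apply: mcontM; [apply: mcontM; [exact: B_cont|exact: Ri_cont]|].
by apply: mcont_tr; exact: B_cont.
Qed.

Lemma schurQ_cont : mcont 0 T schurQ.
Proof.
apply: mcontB; first exact: Q_cont.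
apply: mcontM; [apply: mcontM; [|exact: Ri_cont]|exact: H_cont].
by apply: mcont_tr; exact: H_cont.
Qed.

(** The origin of [kappa]. *)
Lemma feedback_bound t : t \in `[0, T] -> opbound (feedback t) (kappa k).
Proof.
move=> tT; apply: opboundB; first exact: A_bound.
rewrite -mulmxA -mulrA; apply: opbound_mul; [exact/ltW/(lamB_gt0 hk)|exact: B_bound|].
rewrite mulrC; apply: opbound_mul; [by rewrite invr_ge0 ltW// (gamR_gt0 hk)|exact: Ri_bound|].
exact: H_bound.
Qed.

Lemma ctrlmx_bound t : t \in `[0, T] -> opbound (ctrlmx t) (lamB k ^+ 2 / gamR k).
Proof.
move=> tT; rewrite /ctrlmx -mulmxA expr2 -mulrA.
apply: opbound_mul; [exact/ltW/(lamB_gt0 hk)|exact: B_bound|].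
rewrite mulrC; apply: opbound_mul; [by rewrite invr_ge0 ltW// (gamR_gt0 hk)|exact: Ri_bound|].
exact: BT_bound.
Qed.

Lemma ctrlmx_ge0 t x : t \in `[0, T] -> 0 <= dot x (ctrlmx t *m x).
Proof. by move=> tT; rewrite /ctrlmx -!mulmxA dot_mulr Ri_ge0. Qed.

Lemma ctrlmx_sym t : t \in `[0, T] -> (ctrlmx t)^T = ctrlmx t.
Proof. by move=> tT; rewrite /ctrlmx !trmx_mul trmxK Ri_sym// mulmxA. Qed.

Lemma schurQ_sym t : t \in `[0, T] -> (schurQ t)^T = schurQ t.
Proof.
by move=> tT; rewrite /schurQ trmxD trmxN !trmx_mul trmxK Ri_sym// Q_sym// mulmxA.
Qed.

Lemma schurQ_ge t x : t \in `[0, T] -> gamQ k * enorm x ^+ 2 <= dot x (schurQ t *m x).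
Proof.
by move=> tT; rewrite -dot_scalar_mx; apply: loewner_leE; case: hA3 => _ h _ _; exact: h.
Qed.

Lemma ZmatE t : Zmat p S t = feedback t - ctrlmx t *m S t.
Proof. by []. Qed.

Definition riccati_rhs t : 'M[R]_nx :=
  S t *m ctrlmx t *m S t - S t *m feedback t - (feedback t)^T *m S t - schurQ t.

Lemma S_mC1 : mC1 0 T S riccati_rhs.
Proof.
case: hS => /solves_ode_mC1 h _; apply: mC1_eq h => t _.
by rewrite /riccati_rhs /ctrlmx !mulmxA.
Qed.

Lemma S_T : S T = mQT p.
Proof. by case: hS. Qed.

(* [D = S - S^T] satisfies [D' = - D Z - Z^T D] and [D T = 0], so [PhiZ^T D PhiZ = 0]. *)
Lemma S_sym t : t \in `[0, T] -> (S t)^T = S t.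
Proof.
move=> tT; have := tT; rewrite in_itv/= => /andP[t0 tT'].
have hP := mC1_sub t0 (lexx T) (evol_mC1 hPhiZ tT).
have hD : mC1 t T (fun r => S r - (S r)^T)
    (fun r => - ((S r - (S r)^T) *m Zmat p S r) - (Zmat p S r)^T *m (S r - (S r)^T)).
  apply: mC1_eq (mC1_sub t0 (lexx T) (mC1B S_mC1 (mC1_tr S_mC1))) => r /andP[tr rT].
  have rI : r \in `[0, T] by rewrite in_itv/= (le_trans t0 (ltW tr)) (ltW rT).
  rewrite /riccati_rhs ZmatE; move: (schurQ_sym rI) (ctrlmx_sym rI).
  move: (schurQ r) (ctrlmx r) (feedback r) => M K F hM hK.
  by rewrite !(trmxD, trmxN) !trmx_mul trmxK hM hK; mxring.
have hE := mC1M (mC1_tr hP) (mC1M hD hP).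
have := mC1_const tT' hE.
rewrite S_T (evol1 hPhiZ tT) trmx1 mulmx1 mul1mx.
have [_ ->] := hsym; rewrite subrr mul0mx mulmx0 => h.
apply/eqP; rewrite eq_sym -subr_eq0 -h// => r _.
by rewrite !trmx_mul; move: (Zmat p S r) => Z; mxring.
Qed.

Lemma S_dot_sym t x y : t \in `[0, T] -> dot x (S t *m y) = dot (S t *m x) y.
Proof. by move=> tT; rewrite dot_mulr S_sym. Qed.

(** The Lyapunov identity: in [S' + S Z + Z^T S] the drift terms cancel and one copy of [S K S]
    survives with a minus sign, [K] being [ctrlmx]. *)
Lemma closed_loop_C1 s x : s \in `[0, T] ->
  C1 0 T (fun t => dot (PhiZ t s *m x) (S t *m (PhiZ t s *m x)))
    (fun t => - dot (PhiZ t s *m x) (schurQ t *m (PhiZ t s *m x))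
      - dot (S t *m (PhiZ t s *m x)) (ctrlmx t *m (S t *m (PhiZ t s *m x)))).
Proof.
move=> sT; have hx := evol_mC1v hPhiZ x sT.
apply: C1_eq (C1_dot hx (mC1M S_mC1 hx)) => t /andP[t0 tT].
have tI : t \in `[0, T] by rewrite in_itv/= !ltW.
move: (PhiZ t s *m x) => y; rewrite /riccati_rhs ZmatE.
move: (feedback t) (ctrlmx t) (schurQ t) (S t) => F K M P.
rewrite ?(mulmxDl, mulmxDr, mulNmx, mulmxN) ?(dotDr, dotNr, dotDl, dotNl) -!mulmxA.
rewrite (dot_mulr F^T) trmxK (dotC (P *m y) (K *m _)); ring.
Qed.

(* With [K = B R^-1 B^T], the square [(S y - c0 y)^T K (S y - c0 y) >= 0] reduces the
   monotonicity of [y^T S y - c0 |y|^2] along the closed loop to [c0_riccati]. *)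
Lemma S_ge_c0 t x : t \in `[0, T] -> c0 k * enorm x ^+ 2 <= dot x (S t *m x).
Proof.
move=> tT; have := tT; rewrite in_itv/= => /andP[t0 tT'].
have hx := evol_mC1v hPhiZ x tT.
have hV := C1B (C1Z (c0 k) (C1_dot hx hx)) (closed_loop_C1 x tT).
have := C1_le (C1_sub t0 (lexx T) hV).
rewrite (evol1 hPhiZ tT) mul1mx -!enorm_sqr => h.
have {h} := h _ tT'.
move=> h; suff h0 : c0 k * enorm (PhiZ T t *m x) ^+ 2 -
    dot (PhiZ T t *m x) (S T *m (PhiZ T t *m x)) <= 0.
  rewrite -subr_le0; apply: le_trans h0; apply: h => r /andP[tr rT].
  have rI : r \in `[0, T] by rewrite in_itv/= (le_trans t0 (ltW tr)) (ltW rT).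
  move: (PhiZ r t *m x) => y; rewrite ZmatE.
  have hF := dot_opbound_ge y (feedback_bound rI).
  have hK := dot_opbound y (ctrlmx_bound rI).
  have hM := schurQ_ge y rI.
  have hKS := ctrlmx_ge0 (S r *m y - c0 k *: y) rI.
  have hsym' : dot (S r *m y) (ctrlmx r *m y) = dot y (ctrlmx r *m (S r *m y)).
    by rewrite dot_mulr ctrlmx_sym// dotC.
  have hc := ler_wpM2r (sqr_ge0 (enorm y)) (c0_riccati hk).
  have cp := ltW (c0_gt0 hk).
  have hF' := ler_wpM2l cp hF.
  have hK' := ler_wpM2l (sqr_ge0 (c0 k)) hK.
  move: hF' hK' hM hKS hc hsym'.
  move: (feedback r) (ctrlmx r) (schurQ r) (S r) => F K M P hF' hK' hM hKS hc hsym'.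
  rewrite !(mulmxDl, mulmxDr, mulNmx, mulmxN) -!scalemxAr in hKS.
  rewrite !(dotDl, dotDr, dotNl, dotNr, dotZl, dotZr) hsym' in hKS.
  rewrite (dotC (_ *m y)) mulmxDl mulNmx dotDr dotNr -!mulmxA.
  lra.
rewrite subr_le0 S_T; apply: (@le_trans _ _ (gamQ k * enorm (PhiZ T t *m x) ^+ 2)).
  by rewrite ler_wpM2r ?sqr_ge0// c0_le_gamQ.
by rewrite -dot_scalar_mx; apply: loewner_leE; case: hA3.
Qed.

(* The gap between the two sides is [w^T R w] with [w = u + R^-1 (H x + B^T S x)]. *)
Lemma cost_trajectory a b x x' (u : R -> 'cV[R]_nu) : 0 <= a -> b <= T -> mC1 a b x x' ->
  (forall t, a < t < b -> x' t = A t *m x t + B t *m u t) ->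
  exists V', C1 a b (fun t => dot (x t) (S t *m x t)) V' /\
  forall t, a < t < b ->
    - (dot (x t) (Q t *m x t) + 2 * dot (u t) (H t *m x t) + dot (u t) (fR p t *m u t))
      <= V' t.
Proof.
move=> a0 bT hx hx'; eexists; split.
  exact: C1_dot hx (mC1M (mC1_sub a0 bT S_mC1) hx).
move=> t /andP[at_ tb] /=.
have tI : t \in `[0, T] by rewrite in_itv/= (le_trans a0 (ltW at_)) (le_trans (ltW tb) bT).
rewrite hx' ?at_ ?tb//.
(* Keeping [h] opaque lets [R] and [R^-1] cancel before it is expanded. *)
have [h hE] : {h | h = H t *m x t + (B t)^T *m (S t *m x t)} by eexists.
pose w := u t + Ri t *m h.
have hw0 : 0 <= dot w (fR p t *m w).
  apply: le_trans (R_coercive _ tI); rewrite mulr_ge0 ?sqr_ge0//.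
  exact/ltW/(gamR_gt0 hk).
have RRi (y : 'cV[R]_nu) : fR p t *m (Ri t *m y) = y by rewrite mulKVmx// R_unit.
have RiR (y z : 'cV[R]_nu) : dot (Ri t *m y) (fR p t *m z) = dot y z.
  by rewrite dot_mull Ri_sym// mulKmx// R_unit.
move: hw0; rewrite /w [fR p t *m (_ + _)]mulmxDr RRi dotDl !dotDr RiR.
rewrite (dotC (Ri t *m h)) hE.
rewrite /riccati_rhs /schurQ /feedback /ctrlmx.
have hSs := fun y z => S_dot_sym y z tI.
have hRs y z : dot y (Ri t *m z) = dot z (Ri t *m y) by rewrite dot_mulr Ri_sym// dotC.
have hRt := Ri_sym tI.
move: (S t) (Ri t) (A t) (B t) (Q t) (H t) (x t) (u t) hSs hRs hRt => P N F D M L y v hSs hRs hRt.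
rewrite !(trmxD, trmxN) ?trmx_mul ?trmxK.
rewrite !(mulmxDl, mulmxDr, mulNmx, mulmxN) !(dotDl, dotDr, dotNl, dotNr) -!mulmxA hRt.
rewrite !(hSs y) (dot_mull D) !(dot_mulr D) !(dot_mulr L^T) (dot_mulr F^T) !trmxK.
rewrite (hRs (L *m y) (D^T *m _)) (dotC (L *m y) v) (dotC (D^T *m _) v).
lra.
Qed.

Lemma S_ge0 t x : t \in `[0, T] -> 0 <= dot x (S t *m x).
Proof.
move=> tT; apply: le_trans (S_ge_c0 x tT).
by rewrite mulr_ge0 ?sqr_ge0// ltW// c0_gt0.
Qed.

(** The primitive vanishes at the reference time [s], so it contributes at the other endpoint
    only. *)
Lemma C1_expR_int a b (c s : R) : c != 0 ->
  C1 a b (fun t => (expR (2 * c * (t - s)) - 1) / (2 * c)) (fun t => expR (2 * c * (t - s))).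
Proof.
move=> c0; have h := C1Z (2 * c)^-1 (C1B (C1_expR a b (2 * c) s) (C1_cst a b 1)).
rewrite (_ : (fun t => _ / _) = (fun t => (2 * c)^-1 * (expR (2 * c * (t - s)) - 1))); last first.
  by apply/funext => t; rewrite mulrC.
by apply: C1_eq h => t _; rewrite subr0 mulKf// mulf_neq0.
Qed.

(** With [h = H x] and [w = u + R^-1 h], the cost is [x^T Q x + w^T R w - h^T R^-1 h], and the last
    term is dropped. Bounding [|w|^2] by twice the sum of squares produces the 2 and the
    [lamH^2 / gamR^2] of [alpha0']. *)
Lemma running_cost_le t x (u : 'cV[R]_nu) : t \in `[0, T] ->
  dot x (Q t *m x) + 2 * dot u (H t *m x) + dot u (fR p t *m u) <=
  lamQ k * enorm x ^+ 2 + lamR k * (2 * enorm u ^+ 2 + 2 * (lamH k / gamR k) ^+ 2 * enorm x ^+ 2).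
Proof.
move=> tI.
have [h hE] : {h | h = H t *m x} by eexists.
pose w := u + Ri t *m h.
have hw : dot w (fR p t *m w) = dot u (fR p t *m u) + 2 * dot u h + dot h (Ri t *m h).
  rewrite /w [fR p t *m (_ + _)]mulmxDr mulKVmx ?R_unit// dotDl !dotDr.
  rewrite (dot_mull (Ri t)) Ri_sym// mulKmx ?R_unit// (dotC h u) (dotC (Ri t *m h)); ring.
have hw1 : dot w (fR p t *m w) <= lamR k * enorm w ^+ 2 by apply: dot_opbound; exact: R_bound.
have hR0 := Ri_ge0 h tI.
have hQx := dot_opbound x (Q_bound tI).
have hwn : enorm w ^+ 2 <= 2 * enorm u ^+ 2 + 2 * enorm (Ri t *m h) ^+ 2.
  have h1 := enormD u (Ri t *m h); have h2 := enorm_ge0 w.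
  have h3 : enorm w ^+ 2 <= (enorm u + enorm (Ri t *m h)) ^+ 2.
    by rewrite ler_pXn2r// nnegrE addr_ge0 ?enorm_ge0.
  have h4 : 0 <= (enorm u - enorm (Ri t *m h)) ^+ 2 by exact: sqr_ge0.
  lra.
have hRh : enorm (Ri t *m h) ^+ 2 <= (lamH k / gamR k) ^+ 2 * enorm x ^+ 2.
  rewrite -exprMn ler_pXn2r ?nnegrE ?enorm_ge0//; last first.
    by rewrite mulr_ge0 ?enorm_ge0 ?divr_ge0// ltW ?(lamH_gt0 hk) ?(gamR_gt0 hk).
  rewrite hE mulrC (mulrC (lamH k)) mulrC.
  rewrite mulmxA; apply: opbound_mul; last exact: H_bound; last exact: Ri_bound.
  by rewrite invr_ge0 ltW// (gamR_gt0 hk).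
have := ler_wpM2l (ltW (lamR_gt0 hk)) (le_trans hwn (lerD (lexx _) (ler_wpM2l (ler0n R 2) hRh))).
rewrite -hE; lra.
Qed.

(** * Upper bound on the Riccati solution *)

Variable PhiA : R -> R -> 'M[R]_nx.
Hypothesis hPhiA : is_evolution T A PhiA.

Lemma A_bound_kappa t : t \in `[0, T] -> opbound (A t) (kappa k).
Proof. by move=> tT; apply: opbound_le (A_bound tT); exact/ltW/lamA_lt_kappa. Qed.

Lemma S_le_tail t x : 0 <= t -> t <= T -> T <= t + sigma k ->
  dot x (S t *m x) <= c1 k * enorm x ^+ 2.
Proof.
move=> t0 tT Tt; have tI : t \in `[0, T] by rewrite in_itv/= t0.
have k0 := kappa_gt0 hk; have Q0 := lamQ_gt0 hk.
have hx := mC1_sub t0 (lexx T) (evol_mC1v hPhiA x tI).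
have grow r : t <= r <= T -> enorm (PhiA r t *m x) ^+ 2 <= expR (2 * kappa k * (r - t)) * enorm x ^+ 2.
  move=> /andP[tr rT]; have rI : r \in `[0, T] by rewrite in_itv/= (le_trans t0 tr).
  have := evol_opbound A_bound_kappa hPhiA tI rI x.
  rewrite ger0_norm ?subr_ge0// => h.
  rewrite -mulrA expRM_natl -exprMn ler_pXn2r ?nnegrE ?enorm_ge0//.
  by rewrite mulr_ge0 ?enorm_ge0 ?expR_ge0.
have [|V' [hV hV']] := @cost_trajectory t T _ _ (fun=> 0) t0 (lexx T) hx.
  by move=> r _; rewrite mulmx0 addr0.
have k2 : kappa k != 0 by rewrite gt_eqF.
(* Adding a primitive of the bound on the running cost gives a nondecreasing function, whose values
   at [t] and [T] are compared. *)
have hN := C1D hV (C1Z (lamQ k * enorm x ^+ 2) (C1_expR_int t T t k2)).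
have := C1_le hN _ tT; rewrite (evol1 hPhiA tI) mul1mx subrr mulr0 expR0 subrr mul0r mulr0 addr0.
move=> h; apply: (le_trans (h _)) => [r rI|].
  have rI' : r \in `[0, T].
    by case/andP: rI => tr rT; rewrite in_itv/= (le_trans t0 (ltW tr)) ltW.
  have h1 := hV' r rI.
  have h2 := dot_opbound (PhiA r t *m x) (Q_bound rI').
  have h3 : t <= r <= T by case/andP: rI => tr rT; rewrite !ltW.
  have h4 := ler_wpM2l (ltW Q0) (grow r h3).
  move: h1; rewrite [dot 0 _]dotE big1 => [|i _]; last by rewrite mxE mul0r.
  rewrite [dot 0 _]dotE big1 => [|i _]; last by rewrite mxE mul0r.
  lra.
have hT : dot (PhiA T t *m x) (S T *m (PhiA T t *m x)) <= lamQ k * enorm (PhiA T t *m x) ^+ 2.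
  by rewrite S_T -dot_scalar_mx; apply: loewner_leE; case: hA3.
have g := ler_wpM2l (ltW Q0) (grow T (introT andP (conj tT (lexx T)))).
have eT : expR (2 * kappa k * (T - t)) <= expR (2 * kappa k * sigma k).
  by rewrite ler_expR ler_pM2l ?mulr_gt0//; lra.
have x0 := sqr_ge0 (enorm x).
apply: le_trans (ler_wpM2r x0 (c1_ge_tail hk)).
have i0 : 0 < (2 * kappa k)^-1 by rewrite invr_gt0 mulr_gt0.
have e1 := ler_wpM2l (mulr_ge0 (ltW Q0) x0) eT.
have e2 := ler_wpM2r (ltW i0) e1.
lra.
Qed.

(** * Steering to the origin by the Gramian control *)

Section Steering.
Variables t0 t1 : R.
Hypotheses (t00 : 0 <= t0) (t01 : t0 <= t1) (t1T : t1 <= T) (t1s : t1 <= t0 + sigma k).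

Definition gram s : 'M[R]_nx := gramian PhiA B t0 s.

Let t0I : t0 \in `[0, T].
Proof. by rewrite in_itv/= t00 (le_trans t01). Qed.

Let sI s : t0 <= s <= t1 -> s \in `[0, T].
Proof. by move=> /andP[h1 h2]; rewrite in_itv/= (le_trans t00 h1) (le_trans h2). Qed.

Let k0 : 0 < kappa k. Proof. exact: kappa_gt0. Qed.

Lemma gram_mC1 : mC1 t0 t1 gram
  (fun s => PhiA t0 s *m B s *m (B s)^T *m (PhiA t0 s)^T).
Proof.
apply: mC1_mxint => //.
have cP : mcont t0 t1 (fun s => PhiA t0 s).
  have [h _] := evol_mC1_right (ltW k0) A_bound_kappa hPhiA t0I.
  exact: mcont_sub h.
have cB := mcont_sub t00 t1T B_cont.
by apply: mcontM; [apply: mcontM; [exact: mcontM|exact: mcont_tr]|exact: mcont_tr].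
Qed.

Lemma gram_sym s : (gram s)^T = gram s.
Proof.
by rewrite /gram /gramian mxint_tr; apply: mxint_eq => r _; rewrite !trmx_mul !trmxK !mulmxA.
Qed.

Lemma gram_t0 : gram t0 = 0. Proof. exact: mxint_refl. Qed.

Lemma gram_C1 z : C1 t0 t1 (fun s => dot z (gram s *m z))
  (fun s => enorm ((B s)^T *m ((PhiA t0 s)^T *m z)) ^+ 2).
Proof.
have h := C1_dot (mC1_cst t0 t1 z) (mC1M gram_mC1 (mC1_cst t0 t1 z)).
apply: C1_eq h => s _.
rewrite mulmx0 addr0 dotE big1 => [|i _]; last by rewrite mxE mul0r.
by rewrite add0r -!mulmxA !(dot_mulr, enorm_sqr).
Qed.

Lemma gram_le z s : t0 <= s <= t1 -> 0 <= dot z (gram s *m z) <= dot z (gram t1 *m z).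
Proof.
move=> /andP[h1 h2]; have hC := gram_C1 z.
have -> : 0 = dot z (gram t0 *m z) by rewrite gram_t0 mul0mx dotE big1// => i _; rewrite mxE mulr0.
apply/andP; split.
  by apply: (C1_le (C1_sub (lexx _) h2 hC)) => // r _; exact: sqr_ge0.
by apply: (C1_le (C1_sub h1 (lexx _) hC)) => // r _; exact: sqr_ge0.
Qed.

Lemma PhiA_growth c x s r : (forall t, t \in `[0, T] -> opbound (A t) c) ->
  s \in `[0, T] -> r \in `[0, T] ->
  enorm (PhiA s r *m x) <= expR (c * `|s - r|) * enorm x.
Proof. by move=> hc sT rT; apply: (evol_opbound hc hPhiA). Qed.

(** The energy density is at most [lamB^2 expR (2 kappa (s - t0)) |z|^2]; its integral over a length
    [sigma] is the origin of [alpha1']. *)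
Lemma gram_le_alpha1' z s : t0 <= s <= t1 -> dot z (gram s *m z) <= alpha1' k * enorm z ^+ 2.
Proof.
move=> st; have /andP[_ h] := gram_le z st; apply: (le_trans h).
have kn : kappa k != 0 by rewrite gt_eqF.
have hN := C1B (C1Z (lamB k ^+ 2 * enorm z ^+ 2) (C1_expR_int t0 t1 t0 kn)) (gram_C1 z).
have := C1_le hN _ t01.
rewrite gram_t0 mul0mx subrr mulr0 expR0 subrr mul0r mulr0 dotE big1 => [|i _]; last first.
  by rewrite mxE mulr0.
rewrite subrr subr_ge0 => {}h; apply: (le_trans (h _)) => [r /andP[r0 r1]|].
  have rI : r \in `[0, T] by apply: sI; rewrite !ltW.
  rewrite subr_ge0 expR_sqr -!exprMn -mulrA.
  rewrite ler_pXn2r ?nnegrE ?enorm_ge0//; last first.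
    by rewrite !mulr_ge0 ?enorm_ge0 ?expR_ge0// ltW// (lamB_gt0 hk).
  rewrite (le_trans (BT_bound rI _))// ler_pM2l ?(lamB_gt0 hk)//.
  have hop : opbound (PhiA t0 r) (expR (kappa k * (r - t0))).
    move=> y; have := PhiA_growth y A_bound_kappa t0I rI.
    by rewrite distrC ger0_norm// subr_ge0 ltW.
  by rewrite mulrC; apply: opbound_tr hop _; exact: expR_ge0.
have eE : expR (2 * kappa k * (t1 - t0)) <= expR (2 * kappa k * sigma k).
  by rewrite ler_expR ler_pM2l ?mulr_gt0// lerBlDl.
have c : 0 <= lamB k ^+ 2 * enorm z ^+ 2 * (2 * kappa k)^-1.
  apply: mulr_ge0; first by apply: mulr_ge0; exact: sqr_ge0.
  by rewrite invr_ge0 ltW// mulr_gt0.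
have := ler_wpM2l c eE; rewrite /alpha1'; move: (2 * kappa k)^-1 => i; lra.
Qed.

Hypothesis gram_ge : forall z, alpha0 k * enorm z ^+ 2 <= dot z (gram t1 *m z).
Hypothesis gram_le1 : forall z, dot z (gram t1 *m z) <= alpha1 k * enorm z ^+ 2.

Lemma gram_opbound a s : 0 <= a -> (forall z, dot z (gram t1 *m z) <= a * enorm z ^+ 2) ->
  t0 <= s <= t1 -> opbound (gram s) a.
Proof.
move=> a0 ha st; apply: (psd_opbound (gram_sym s) _ _ a0) => z.
  by have /andP[] := gram_le z st.
by have /andP[_ h] := gram_le z st; exact: le_trans (ha z).
Qed.

(* The Gramian control steers [x0] to 0 at [t1], and [z^T (gram s) z] is the energy it has
   spent up to [s].  Adding to [x^T S x] that energy and explicit primitives of the bounds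
   on [|x|^2] makes a nondecreasing function. *)
Lemma S_le_steer x0 : dot x0 (S t0 *m x0) <= c1 k * enorm x0 ^+ 2.
Proof.
have [->|x00] := eqVneq x0 0.
  by rewrite enorm0 expr0n mulr0 mulmx0 dotE big1// => i _; rewrite mxE mul0r.
have a0p := alpha0_gt0 hk; have a1p := alpha1_gt0 hk; have a1'p := alpha1'_gt0 hk.
have A0 := lamA_gt0 hk; have R0 := lamR_gt0 hk; have Q0 := lamQ_gt0 hk.
have xp := enorm_gt0 x00.
have t1m : t0 <= t1 <= t1 by rewrite t01 lexx.
(* Comparing two multiples of [|x0|^2] needs a nonzero vector, hence the earlier case
   distinction. *)
have a01 : alpha0 k <= alpha1' k.
  have := le_trans (gram_ge x0) (gram_le_alpha1' x0 t1m).
  by rewrite ler_pM2r// exprn_gt0.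
pose z := invmx (gram t1) *m x0.
have Wz : gram t1 *m z = x0 by rewrite /z mulKVmx// (coercive_unit a0p gram_ge).
have zb : enorm z <= (alpha0 k)^-1 * enorm x0 by exact: (coercive_inv_opbound a0p gram_ge).
(* Variation of constants for the control [u] below: the integral of the input is [gram s *m z], so
   the state vanishes at [t1] because [gram t1 *m z = x0]. *)
pose x s := PhiA s t0 *m (x0 - gram s *m z).
pose u s := - ((B s)^T *m ((PhiA t0 s)^T *m z)).
have hx : mC1 t0 t1 x (fun s => A s *m x s + B s *m u s).
  have h := mC1M (mC1_sub t00 t1T (evol_mC1 hPhiA t0I))
    (mC1B (mC1_cst t0 t1 x0) (mC1M gram_mC1 (mC1_cst t0 t1 z))).
  apply: mC1_eq h => s /andP[s0 s1].
  have sI' : s \in `[0, T] by apply: sI; rewrite !ltW.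
  rewrite mulmx0 addr0 sub0r mulmxN !mulmxA (evol_comp A_bound_kappa hPhiA)//.
  by rewrite (evol1 hPhiA sI') mul1mx /x /u mulmxN !mulmxA.
have xb c a s : (forall t, t \in `[0, T] -> opbound (A t) c) -> 0 <= a ->
    (forall z, dot z (gram t1 *m z) <= a * enorm z ^+ 2) -> t0 <= s <= t1 ->
    enorm (x s) ^+ 2 <= expR (2 * c * (s - t0)) * ((1 + a / alpha0 k) ^+ 2 * enorm x0 ^+ 2).
  move=> hc ha hga st; rewrite expR_sqr -!exprMn ler_pXn2r ?nnegrE ?enorm_ge0//; last first.
    by rewrite !mulr_ge0 ?expR_ge0 ?enorm_ge0// addr_ge0// divr_ge0// ltW.
  have := PhiA_growth (x0 - gram s *m z) hc (sI st) t0I.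
  have /andP[s0 _] := st; rewrite ger0_norm ?subr_ge0// => /le_trans; apply.
  rewrite ler_wpM2l ?expR_ge0// (le_trans (enormD _ _))// enormN mulrDl mul1r lerD2l.
  rewrite (le_trans (gram_opbound ha hga st _))// -mulrA ler_wpM2l//.
have kn : kappa k != 0 by rewrite gt_eqF.
have An : lamA k != 0 by rewrite gt_eqF.
have [V' [hV hV']] := cost_trajectory t00 t1T hx (fun s _ => erefl).
(* The state is estimated in two ways. The [lamQ] term uses rate [kappa] with [alpha1'], as in [c1];
   the cross term uses rate [lamA] with [alpha1], as in [alpha0']. *)
pose a := lamQ k * ((1 + alpha1' k / alpha0 k) ^+ 2 * enorm x0 ^+ 2).
pose b := lamR k * (2 * (lamH k / gamR k) ^+ 2 * ((1 + alpha1 k / alpha0 k) ^+ 2 * enorm x0 ^+ 2)).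
have hN := C1D (C1D (C1D hV (C1Z (2 * lamR k) (gram_C1 z)))
  (C1Z a (C1_expR_int t0 t1 t0 kn))) (C1Z b (C1_expR_int t0 t1 t0 An)).
have := C1_le hN _ t01.
have -> : x t0 = x0 by rewrite /x (evol1 hPhiA t0I) gram_t0 mul0mx subr0 mul1mx.
have -> : x t1 = 0 by rewrite /x Wz subrr mulmx0.
rewrite gram_t0 mul0mx mulmx0 Wz.
have d0 (y : 'cV[R]_nx) : dot y 0 = 0 by rewrite dotE big1// => i _; rewrite mxE mulr0.
rewrite !d0 subrr !mulr0 expR0 subrr !mul0r !mulr0 !addr0 add0r => h.
apply: (le_trans (h _)) => [s sab|].
  have st : t0 <= s <= t1 by case/andP: sab => s0 s1; rewrite !ltW.
  have sT := sI st.
  have h1 := hV' s sab.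
  have h2 := running_cost_le (x s) (u s) sT.
  have hxa := ler_wpM2l (ltW Q0) (xb _ _ s A_bound_kappa (ltW a1'p) (fun z => gram_le_alpha1' z t1m) st).
  have H0 : 0 <= 2 * (lamH k / gamR k) ^+ 2 by rewrite mulr_ge0// sqr_ge0.
  have hxb := ler_wpM2l (ltW R0) (ler_wpM2l H0 (xb _ _ s A_bound (ltW a1p) gram_le1 st)).
  have hu : enorm (u s) = enorm ((B s)^T *m ((PhiA t0 s)^T *m z)) by rewrite enormN.
  rewrite -hu /a /b; lra.
have zx : dot z x0 <= (alpha0 k)^-1 * enorm x0 ^+ 2.
  rewrite (le_trans (cauchy_schwarz _ _))// expr2 mulrA; apply: ler_wpM2r => //; exact: ltW.
have st := c1_ge_steer hk a01.
have x2 := sqr_ge0 (enorm x0).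
apply: le_trans (ler_wpM2r x2 st).
have hs : t1 - t0 <= sigma k by rewrite lerBlDl.
have eE c : 0 < c -> (expR (2 * c * (t1 - t0)) - 1) / (2 * c) <= (expR (2 * c * sigma k) - 1) / (2 * c).
  by move=> c0; rewrite ler_pM2r ?invr_gt0 ?mulr_gt0// lerD2r ler_expR ler_pM2l ?mulr_gt0.
have a0 : 0 <= a by rewrite /a mulr_ge0 ?(ltW Q0)// mulr_ge0 ?sqr_ge0.
have b0 : 0 <= b.
  apply: mulr_ge0; first exact: ltW.
  by apply: mulr_ge0; apply: mulr_ge0; rewrite ?sqr_ge0.
have ea := ler_wpM2l a0 (eE _ k0).
have eb := ler_wpM2l b0 (eE _ A0).
have ez := ler_wpM2l (mulr_ge0 (ler0n R 2) (ltW R0)) zx.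
(* This is [lamR] times the second summand of [1 / alpha0']; the energy bound [2 lamR / alpha0]
   supplies the first. *)
have bE : b * ((expR (2 * lamA k * sigma k) - 1) / (2 * lamA k)) =
    lamR k * (lamH k ^+ 2 / (gamR k ^+ 2 * lamA k) * (1 + alpha1 k / alpha0 k) ^+ 2
     * (expR (2 * lamA k * sigma k) - 1)) * enorm x0 ^+ 2.
  rewrite /b; move: (1 + _) (expR _ - 1) => w e.
  by field; rewrite An (gt_eqF (gamR_gt0 hk)).
rewrite /alpha0' invrK; rewrite bE in eb; move: ea eb ez; rewrite /a; lra.
Qed.

End Steering.

Hypothesis hA2 : assumption_A2 T p k PhiA.

Lemma S_le_c1 t x : t \in `[0, T] -> dot x (S t *m x) <= c1 k * enorm x ^+ 2.
Proof.
rewrite in_itv/= => /andP[t0 tT].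
have [tT'|tT'] := leP t (T - sigma k); last first.
  by apply: S_le_tail => //; rewrite -lerBlDr ltW.
have [_ /(_ t)] := hA2; rewrite t0 tT' => /(_ isT)[t1 [/andP[tt1 t1s] h0 h1 _ _]].
apply: (@S_le_steer t t1) => //.
- by rewrite (le_trans t1s)// -lerBrDr.
- by move=> z; rewrite -dot_scalar_mx; exact: loewner_leE.
- by move=> z; rewrite -dot_scalar_mx; exact: loewner_leE.
Qed.

Lemma S_bound t : t \in `[0, T] -> opbound (S t) (c1 k).
Proof.
move=> tT; apply: (psd_opbound (S_sym tT)) => [z|z|]; last exact/ltW/c1_gt0.
  exact: S_ge0.
exact: S_le_c1.
Qed.

(** The form [y^T S y] decays at rate [gamQ / c1]. Returning to the norm takes a square root, which
    halves the rate into [rhoZ] and turns [c1 / c0] into [cZ]. *)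
Lemma PhiZ_decay s t : 0 <= s -> s <= t -> t <= T ->
  opbound (PhiZ t s) (cZ k * expR (- (rhoZ k * (t - s)))).
Proof.
move=> s0 st tT x; have sI : s \in `[0, T] by rewrite in_itv/= s0 (le_trans st).
have tI : t \in `[0, T] by rewrite in_itv/= (le_trans s0).
have c0p := c0_gt0 hk; have c1p := c1_gt0 hk; have gp := gamQ_gt0 hk.
have := gronwall (k := - (gamQ k / c1 k)) (C1_sub s0 tT (closed_loop_C1 x sI)) _ st.
rewrite (evol1 hPhiZ sI) mul1mx => h.
have {}h : dot (PhiZ t s *m x) (S t *m (PhiZ t s *m x)) <=
    expR (- (gamQ k / c1 k) * (t - s)) * dot x (S s *m x).
  apply: h => r /andP[sr rt].
  have rI : r \in `[0, T] by rewrite in_itv/= (le_trans s0 (ltW sr)) (le_trans (ltW rt) tT).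
  move: (PhiZ r s *m x) => y.
  have h1 := schurQ_ge y rI; have h2 := ctrlmx_ge0 (S r *m y) rI.
  have h3 := ler_wpM2l (ltW (divr_gt0 gp c1p)) (S_le_c1 y rI).
  have h4 : gamQ k / c1 k * (c1 k * enorm y ^+ 2) = gamQ k * enorm y ^+ 2.
    by field; rewrite gt_eqF.
  rewrite h4 in h3; lra.
have h1 := S_ge_c0 (PhiZ t s *m x) tI.
have h2 := ler_wpM2l (expR_ge0 (- (gamQ k / c1 k) * (t - s))) (S_le_c1 x sI).
have {h1 h2}h3 := le_trans h1 (le_trans h h2).
have r0 : 0 <= cZ k * expR (- (rhoZ k * (t - s))) * enorm x.
  by rewrite mulr_ge0 ?enorm_ge0// mulr_ge0 ?expR_ge0 ?cZ_ge0.
rewrite -(@ler_pXn2r _ 2)// ?nnegrE ?enorm_ge0//.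
have q0 : 0 <= c1 k / c0 k by apply: divr_ge0; exact: ltW.
rewrite !exprMn /cZ (sqr_sqrtr q0).
have -> : expR (- (rhoZ k * (t - s))) ^+ 2 = expR (- (gamQ k / c1 k) * (t - s)).
  rewrite -expRM_natl; congr expR; rewrite /rhoZ; field; by rewrite gt_eqF.
rewrite -(ler_pM2l c0p). apply: (le_trans h3); rewrite le_eqVlt; apply/orP; left; apply/eqP.
by field; rewrite gt_eqF.
Qed.

(** * Coefficients of the closed-loop formulas *)

Local Notation C := (fC p).
Local Notation G := (fG p).
Local Notation W := (fW p).
Local Notation Z := (Zmat p S).
Local Notation Y := (Ymat p S).

Hypothesis hA4 : assumption_A4 T p k.

Lemma G_bound t : t \in `[0, T] -> opbound (G t) (lamG k).
Proof. by case: hA4 => _ [h _ _ _]; exact: supnorm_opbound. Qed.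
Lemma W_bound t : t \in `[0, T] -> opbound (W t) (lamW k).
Proof. by case: hA4 => _ [_ h _ _]; exact: supnorm_opbound. Qed.
Lemma C_bound t : t \in `[0, T] -> opbound (C t) (lamC k).
Proof. by case: hA4 => _ [_ _ h _]; exact: supnorm_opbound. Qed.

Lemma S_cont : mcont 0 T S. Proof. by case: S_mC1. Qed.

Lemma Z_cont : mcont 0 T Z.
Proof.
apply: mcontB; first exact: feedback_cont.
by apply: mcontM; [exact: ctrlmx_cont|exact: S_cont].
Qed.

Definition inputmx t : 'M[R]_(nx, nd) := C t - B t *m Ri t *m (W t)^T.

(** A crude bound, good for differentiating [PhiZ] in its second argument; the decay comes from
    [PhiZ_decay]. *)
Lemma Z_bound t : t \in `[0, T] -> opbound (Z t) (kappa k + lamB k ^+ 2 / gamR k * c1 k).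
Proof.
move=> tT; apply: opboundB; first exact: feedback_bound.
apply: opbound_mul; [|exact: ctrlmx_bound|exact: S_bound].
by rewrite divr_ge0 ?sqr_ge0// ltW// (gamR_gt0 hk).
Qed.

Lemma Y_bound t : t \in `[0, T] ->
  opbound (Y t) ((lamW k * lamB k / gamR k + lamC k) * c1 k + lamW k * lamH k / gamR k + lamG k).
Proof.
move=> tT.
have g0 : 0 <= (gamR k)^-1 by rewrite invr_ge0 ltW// (gamR_gt0 hk).
have W0 := ltW (lamW_gt0 hk); have B0 := ltW (lamB_gt0 hk).
apply: (@opbound_le _ _ _ _ (lamW k * (gamR k)^-1 * (lamB k * c1 k + lamH k) + (lamG k + lamC k * c1 k))).
  by rewrite le_eqVlt; apply/orP; left; apply/eqP; ring.
apply: opboundB.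
  apply: opbound_mul; first by rewrite mulr_ge0.
    by apply: opbound_mul => //; [exact: W_bound|exact: Ri_bound].
  apply: opboundD; last exact: H_bound.
  by apply: opbound_mul => //; [exact: BT_bound|exact: S_bound].
apply: opboundD; first exact: G_bound.
have C0 := ltW (lamC_gt0 hk).
by apply: opbound_mul => //; [apply: opbound_tr => //; exact: C_bound|exact: S_bound].
Qed.

Lemma inputmx_bound t : t \in `[0, T] ->
  opbound (inputmx t) (lamW k * lamB k / gamR k + lamC k).
Proof.
move=> tT.
have g0 : 0 <= (gamR k)^-1 by rewrite invr_ge0 ltW// (gamR_gt0 hk).
have W0 := ltW (lamW_gt0 hk); have B0 := ltW (lamB_gt0 hk).
apply: (@opbound_le _ _ _ _ (lamC k + lamB k * (gamR k)^-1 * lamW k)).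
  by rewrite le_eqVlt; apply/orP; left; apply/eqP; ring.
apply: opboundB; first exact: C_bound.
apply: opbound_mul; first by rewrite mulr_ge0.
  by apply: opbound_mul => //; [exact: B_bound|exact: Ri_bound].
by apply: opbound_tr => //; exact: W_bound.
Qed.

Lemma PhiZ_mC1_right t : t \in `[0, T] ->
  mC1 0 T (fun s => PhiZ t s) (fun s => - (PhiZ t s *m Z s)).
Proof.
move=> tT; apply: (evol_mC1_right _ Z_bound hPhiZ tT).
rewrite addr_ge0 ?(ltW (kappa_gt0 hk))// mulr_ge0 ?(ltW (c1_gt0 hk))//.
by rewrite divr_ge0 ?sqr_ge0// ltW// (gamR_gt0 hk).
Qed.

(** * Closed-loop formulas for the optimal solution *)

Section Optimal.
Variables (d : R -> 'cV[R]_nd) (d0 : 'cV[R]_nx) (dT : 'cV[R]_nd).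
Variables (x : R -> 'cV[R]_nx) (u : R -> 'cV[R]_nu) (lam : R -> 'cV[R]_nx).
Hypothesis hopt : lq_optimal T p d d0 dT x u lam.

(** The function [v] of the solution formulas, read off from the optimal triple. *)
Definition adj t : 'cV[R]_nx := lam t - S t *m x t.

Let xF t : 'cV[R]_nx := A t *m x t + B t *m u t + C t *m d t.
Let lamF t : 'cV[R]_nx :=
  - ((A t)^T *m lam t) - Q t *m x t - (H t)^T *m u t - (G t)^T *m d t.

Let hx : solves_ode_ae T x xF. Proof. by case: hopt => [[[]]]. Qed.
Let hlam : solves_ode_ae T lam lamF. Proof. by case: hopt => _ []. Qed.
Let hu t : t \in `[0, T] -> u t = control_law p d x lam t.
Proof. by case: hopt => _ _; exact. Qed.

(* Integration by parts of [(PhiZ s t)^T (lam s - S s x s)] over [t, T]. *)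
Lemma adj_formula t : t \in `[0, T] ->
  adj t = (PhiZ T t)^T *m (mGT p)^T *m dT
    - mxint t T (fun s => (PhiZ s t)^T *m (Y s)^T *m d s).
Proof.
move=> tT; have := tT; rewrite in_itv/= => /andP[t0 tT'].
have hP := mC1_sub t0 (lexx T) (evol_mC1 hPhiZ tT).
have hM1 := mC1_tr hP.
have hM2 := mC1N (mC1M hM1 (mC1_sub t0 (lexx T) S_mC1)).
have cP : mcont t T (fun s => PhiZ s t) by case: hP.
have cZ := mcont_sub t0 (lexx T) Z_cont.
have cS := mcont_sub t0 (lexx T) S_cont.
have cR : mcont t T riccati_rhs.
  apply: mcont_sub t0 (lexx T) _.
  have cF := feedback_cont; have cK := ctrlmx_cont; have cM := schurQ_cont; have cS' := S_cont.
  apply: mcontB => //; apply: mcontB; first (apply: mcontB; last exact: mcontM).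
    by apply: mcontM => //; exact: mcontM.
  by apply: mcontM => //; exact: mcont_tr.
have cM1 : mcont t T (fun s => (Z s *m PhiZ s t)^T).
  by apply: mcont_tr; exact: mcontM.
have cM2 : mcont t T (fun s => - ((Z s *m PhiZ s t)^T *m S s + (PhiZ s t)^T *m riccati_rhs s)).
  by apply: mcontN; apply: mcontD; apply: mcontM => //; exact: mcont_tr.
have il : mint t T lamF by apply: (mint_sub t0 (lexx T)); have [] := hlam.
have ix : mint t T xF by apply: (mint_sub t0 (lexx T)); have [] := hx.
(* [lam] is paired with [PhiZ^T] and [x] with [- PhiZ^T S], since each is only absolutely
   continuous; the two identities are then added. *)
have [i1 e1] := mxint_by_parts tT' hM1 cM1 il
  (fun s st => solves_ode_ae_from hlam t0 (proj1 (andP st)) (proj2 (andP st))).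
have [i2 e2] := mxint_by_parts tT' hM2 cM2 ix
  (fun s st => solves_ode_ae_from hx t0 (proj1 (andP st)) (proj2 (andP st))).
have e := mxintD i1 i2; rewrite e1 e2 in e.
rewrite (evol1 hPhiZ tT) trmx1 !mul1mx S_T in e.
have lamT : lam T = mQT p *m x T + (mGT p)^T *m dT by case: hopt => _ [].
rewrite -(mxint_eq (F := fun s => (PhiZ s t)^T *m (Y s)^T *m d s)) in e.
  by rewrite e /adj lamT; mxring.
move=> s /andP[ts sT]; have sI : s \in `[0, T] by rewrite in_itv/= sT (le_trans t0).
(* Inserting the stationarity condition and the Riccati equation cancels every term in [x] and
   [lam], leaving the one in [d]. *)
rewrite /lamF /xF hu// /control_law /Ymat /riccati_rhs ZmatE /schurQ /feedback /ctrlmx.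
move: (S_sym sI) (Ri_sym sI).
move: (PhiZ s t) (S s) (Ri s) (A s) (B s) (C s) (Q s) (H s) (G s) (W s) (x s) (lam s) (d s).
move=> P V N a b c q h g w y l e' hV hN.
rewrite !(trmx_mul, trmxD, trmxN, trmxK) hV hN.
mxring.
Qed.

Definition state_input t : 'cV[R]_nx := - (ctrlmx t *m adj t) + inputmx t *m d t.

(** Integration by parts of [PhiZ t s *m x s] in [s]. Stationarity with [lam = S x + adj] closes the
    loop, and what is left of [x' - Z x] is [state_input]. *)
Lemma state_formula t : t \in `[0, T] ->
  mint 0 t (fun s => PhiZ t s *m state_input s) /\
  x t = PhiZ t 0 *m d0 + mxint 0 t (fun s => PhiZ t s *m state_input s).
Proof.
move=> tT; have := tT; rewrite in_itv/= => /andP[t0 tT'].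
have hM := mC1_sub (lexx 0) tT' (PhiZ_mC1_right tT).
have cP : mcont 0 t (fun s => PhiZ t s) by case: hM.
have cM : mcont 0 t (fun s => - (PhiZ t s *m Z s)).
  by apply: mcontN; apply: mcontM => //; apply: mcont_sub (lexx 0) tT' Z_cont.
have ix : mint 0 t xF by apply: (mint_sub (lexx 0) tT'); have [] := hx.
have [i1 e1] := mxint_by_parts t0 hM cM ix
  (fun s st => solves_ode_ae_from hx (lexx 0) (proj1 (andP st)) (le_trans (proj2 (andP st)) tT')).
have E s : 0 <= s <= t ->
    - (PhiZ t s *m Z s) *m x s + PhiZ t s *m xF s = PhiZ t s *m state_input s.
  move=> /andP[s0 st]; have sI : s \in `[0, T] by rewrite in_itv/= s0 (le_trans st).
  rewrite /state_input /adj /xF hu// /control_law ZmatE /inputmx /feedback /ctrlmx.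
  move: (PhiZ t s) (S s) (Ri s) (A s) (B s) (C s) (H s) (W s) (x s) (lam s) (d s).
  by move=> P V N a b c h w y l e'; mxring.
split; first exact: mint_eq E i1.
rewrite -(mxint_eq E) e1 (evol1 hPhiZ tT) mul1mx.
have [[[_ _ _ ->] _] _ _] := hopt.
by rewrite addrC subrK.
Qed.

(** * Response to the Dirac term *)

Variables (t' : R) (l : 'cV[R]_nd).
Hypotheses (t'0 : 0 <= t') (t'T : t' <= T).

Let t'I : t' \in `[0, T]. Proof. by rewrite in_itv/= t'0. Qed.

(** The formula for [v] at [s] integrates over [[s, T]], which contains the atom exactly when
    [s <= t'], equality included. *)
Definition adj_jump s : 'cV[R]_nx :=
  if s <= t' then - ((PhiZ t' s)^T *m ((Y t')^T *m l)) else 0.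

Local Notation x_p := (x_pert T p S PhiZ d d0 dT t' l).
Local Notation v_p := (v_pert T p S PhiZ d dT t' l).
Local Notation u_p := (u_pert T p S PhiZ d d0 dT t' l).
Local Notation lam_p := (lam_pert T p S PhiZ d d0 dT t' l).
Local Notation decay t := (expR (- (rhoZ k * `|t - t'|))).

Lemma v_pertE s : s \in `[0, T] -> v_p s = adj s + adj_jump s.
Proof.
move=> sI; rewrite adj_formula// /v_pert /mxint_dirac /adj_jump t'T andbT opprD addrA.
by case: ifP => _; rewrite ?oppr0// mulmxA.
Qed.

(** The adjoint feels the atom backward in time through the transpose of the forward operator, so
    the same decay applies; the remaining factor of [cv] is the bound on [Y]. *)
Lemma adj_jump_le s : 0 <= s -> s <= t' ->
  enorm ((PhiZ t' s)^T *m ((Y t')^T *m l)) <= cv k * expR (- (rhoZ k * (t' - s))) * enorm l.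
Proof.
move=> s0 st'.
have P0 : 0 <= cZ k * expR (- (rhoZ k * (t' - s))) by rewrite mulr_ge0 ?cZ_ge0 ?expR_ge0.
have hP := opbound_tr P0 (PhiZ_decay s0 st' t'T).
have hY := Y_bound t'I; rewrite /cv; set y := (_ + lamG k) in hY *.
have y0 : 0 <= y.
  have := (lamG_gt0 hk, lamW_gt0 hk, lamB_gt0 hk, lamC_gt0 hk).
  move=> [[[h1 h2] h3] h4]; have h5 := lamH_gt0 hk; have h6 := gamR_gt0 hk; have h7 := c1_gt0 hk.
  rewrite ltW// /y; move: (c1 k) h7 => c h7.
  by rewrite !(addr_gt0, mulr_gt0, invr_gt0).
apply: (le_trans (hP _)); rewrite [leRHS](_ : _ = cZ k * expR (- (rhoZ k * (t' - s))) * (y * enorm l)).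
  by rewrite ler_wpM2l//; apply: opbound_tr hY _.
by ring.
Qed.

Lemma adj_jump_bound s : s \in `[0, T] -> enorm (adj_jump s) <= cv k * decay s * enorm l.
Proof.
rewrite in_itv/= => /andP[s0 sT]; rewrite /adj_jump; case: ifPn => [st'|_].
  rewrite enormN (le_trans (adj_jump_le s0 st'))//.
  by rewrite distrC ger0_norm// subr_ge0.
rewrite enorm0; apply: mulr_ge0 (enorm_ge0 l); apply: mulr_ge0 (expR_ge0 _).
exact/ltW/cv_gt0.
Qed.

(** The effect at time [t] of the change of [v] at time [s]; the minus signs of [state_input] and
    [adj_jump] cancel. *)
Let kick t s : 'cV[R]_nx :=
  PhiZ t s *m (ctrlmx s *m ((PhiZ t' s)^T *m ((Y t')^T *m l))).

Let kick_cont t : t \in `[0, T] -> mcont 0 T (kick t).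
Proof.
move=> tI; apply: mcontM; first by have [] := PhiZ_mC1_right tI.
apply: mcontM; first exact: ctrlmx_cont.
apply: mcontM; last exact: mcont_cst.
by apply: mcont_tr; have [] := PhiZ_mC1_right t'I.
Qed.

(** Two contributions remain: an indirect one, through the changed adjoint and hence only up to
    [t'], and the atom acting directly on the state from [t'] on. *)
Lemma x_pertE t : t \in `[0, T] -> x_p t - x t =
  mxint 0 (Num.min t t') (kick t) +
  (if t' <= t then PhiZ t t' *m (inputmx t' *m l) else 0).
Proof.
move=> tI; have := tI; rewrite in_itv/= => /andP[t0 tT].
have [i0 ->] := state_formula tI.
have ik : mint 0 t (kick t) by apply: mint_cont; exact: mcont_sub (lexx 0) tT (kick_cont tI).
have [i1 e1] := mxint_cut t'0 t0 ik.
rewrite /x_pert /mxint_dirac t'0 /=.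
rewrite (mxint_eq (G := fun s => PhiZ t s *m state_input s + (if s <= t' then kick t s else 0))).
  rewrite mxintD// e1 /inputmx; move: (if t' <= t then _ else _) => D.
  move: (mxint 0 t _) (mxint 0 (Num.min t t') _) (PhiZ t 0 *m d0) => a b c; mxring.
move=> s /andP[s0 st]; have sI : s \in `[0, T] by rewrite in_itv/= s0 (le_trans st).
rewrite v_pertE// /state_input /adj_jump /kick /inputmx -/(ctrlmx s).
move: (ctrlmx s) (C s - _) (adj s) => K I a.
by case: ifP => _; mxring.
Qed.

Lemma dx_bound t : t \in `[0, T] ->
  enorm (x_p t - x t) <= Lambda_x k * decay t * enorm l.
Proof.
move=> tI; have := tI; rewrite in_itv/= => /andP[t0 tT].
rewrite x_pertE//.
have g0 := gamR_gt0 hk; have r0 := rhoZ_gt0 hk; have cZ0 := cZ_ge0 k.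
have cv0 := ltW (cv_gt0 hk); have l0 := enorm_ge0 l; have D0 := expR_ge0 (- (rhoZ k * `|t - t'|)).
pose tau := Num.min t t'.
have tau0 : 0 <= tau by rewrite le_min t0.
have beta0 : 0 <= lamB k ^+ 2 / gamR k by rewrite divr_ge0 ?sqr_ge0// ltW.
pose K := cZ k * (lamB k ^+ 2 / gamR k) * cv k * decay t * enorm l.
have K0 : 0 <= K := mulr_ge0 (mulr_ge0 (mulr_ge0 (mulr_ge0 cZ0 beta0) cv0) D0) l0.
have b1 : enorm (mxint 0 tau (kick t)) <= K / (2 * rhoZ k).
  have rn : rhoZ k != 0 by rewrite gt_eqF.
  have hE := C1Z K (C1_expR_int 0 tau tau rn).
  have cE : {within `[0, tau], continuous (fun s => K * expR (2 * rhoZ k * (s - tau)))}.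
    by have [] := C1Z K (C1_expR 0 tau (2 * rhoZ k) tau).
  have tauT : tau <= T by rewrite ge_min tT.
  have ik : mint 0 tau (kick t).
    by apply: mint_cont; exact: mcont_sub (lexx 0) tauT (kick_cont tI).
  apply: (le_trans (enorm_mxint_le ik (cont_integrable cE) _)) => [s /andP[s0 stau]|].
    have [st st'] : s <= t /\ s <= t' by move: stau; rewrite le_min => /andP.
    have sI : s \in `[0, T] by rewrite in_itv/= s0 (le_trans st).
    have h1 := PhiZ_decay s0 st tT; have h2 := ctrlmx_bound sI; have h3 := adj_jump_le s0 st'.
    apply: (le_trans (h1 _)).
    have e0 : 0 <= cZ k * expR (- (rhoZ k * (t - s))) by rewrite mulr_ge0 ?expR_ge0.
    apply: (le_trans (ler_wpM2l e0 (le_trans (h2 _) (ler_wpM2l beta0 h3)))).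
    (* With [tau] the minimum of [t] and [t'], [(t - s) + (t' - s) = |t - t'| + 2 (tau - s)]. The
       first part leaves the integral as the claimed decay; the second integrates to at most
       [1 / (2 rhoZ)]. *)
    have ee : expR (- (rhoZ k * (t - s))) * expR (- (rhoZ k * (t' - s))) =
        decay t * expR (2 * rhoZ k * (s - tau)).
      rewrite -!expRD; congr expR; rewrite /tau.
      have [tt'|tt'] := leP t t'.
        by rewrite ler0_norm ?subr_le0//; ring.
      by rewrite gtr0_norm ?subr_gt0//; ring.
    rewrite le_eqVlt; apply/orP; left; apply/eqP.
    rewrite /K [RHS](_ : _ = cZ k * (lamB k ^+ 2 / gamR k) * cv k * enorm l *
      (decay t * expR (2 * rhoZ k * (s - tau)))); last by ring.
    by rewrite -ee; ring.
  rewrite (Rintegral_C1 tau0 hE cE) subrr mulr0 expR0 subrr mul0r mulr0.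
  have i0 : 0 <= K / (2 * rhoZ k) by apply: divr_ge0 => //; rewrite mulr_ge0// ltW.
  have := mulr_ge0 i0 (expR_ge0 (2 * rhoZ k * (0 - tau))); lra.
have b2 : enorm (if t' <= t then PhiZ t t' *m (inputmx t' *m l) else 0) <=
    cZ k * (lamW k * lamB k / gamR k + lamC k) * decay t * enorm l.
  have i0 : 0 <= lamW k * lamB k / gamR k + lamC k.
    have := (lamW_gt0 hk, lamB_gt0 hk, lamC_gt0 hk) => -[[h1 h2] h3].
    by rewrite ltW// !(addr_gt0, mulr_gt0, invr_gt0).
  case: ifPn => [tt'|_]; last first.
    by rewrite enorm0; exact: mulr_ge0 (mulr_ge0 (mulr_ge0 cZ0 i0) D0) l0.
  apply: (le_trans (PhiZ_decay t'0 tt' tT _)).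
  rewrite -[in leLHS](@ger0_norm _ (t - t')) ?subr_ge0//.
  apply: (le_trans (ler_wpM2l (mulr_ge0 cZ0 D0) (inputmx_bound t'I l))).
  by rewrite le_eqVlt; apply/orP; left; apply/eqP; ring.
apply: (le_trans (enormD _ _)); apply: (le_trans (lerD b1 b2)).
rewrite le_eqVlt; apply/orP; left; apply/eqP; rewrite /Lambda_x /K.
move: (cZ k) (cv k) (decay t) (enorm l) => z c D n.
by field; rewrite !gt_eqF.
Qed.

Lemma perturbation_bound t : t \in `[0, T] ->
  enorm (x_p t - x t) + enorm (u_p t - u t) + enorm (lam_p t - lam t)
    <= enorm l * (Lambda k * decay t).
Proof.
move=> tI; have hdx := dx_bound tI; have hj := adj_jump_bound tI.
have g0 := gamR_gt0 hk; have H0 := ltW (lamH_gt0 hk); have B0 := ltW (lamB_gt0 hk).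
have c10 := ltW (c1_gt0 hk).
have lamE : lam_p t - lam t = S t *m (x_p t - x t) + adj_jump t.
  rewrite /lam_pert v_pertE// /adj.
  by move: (x_p t) (S t) (x t) (lam t) (adj_jump t) => a b c e f; mxring.
have hdl : enorm (lam_p t - lam t) <= c1 k * (Lambda_x k * decay t * enorm l) + cv k * decay t * enorm l.
  rewrite lamE (le_trans (enormD _ _))// lerD// (le_trans (S_bound tI _))//.
  exact: ler_wpM2l.
(* The terms in [d] cancel because [u_pert] evaluates the parameter at [d t], so the control is
   governed by the two other differences. *)
have uE : u_p t - u t = - (Ri t *m (H t *m (x_p t - x t) + (B t)^T *m (lam_p t - lam t))).
  rewrite /u_pert hu// /control_law.
  by move: (x_p t) (lam_p t) (x t) (lam t) (Ri t) => a b c e f; mxring.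
have hdu : enorm (u_p t - u t) <= (gamR k)^-1 * (lamH k * enorm (x_p t - x t) +
    lamB k * enorm (lam_p t - lam t)).
  rewrite uE enormN (le_trans (Ri_bound tI _))// ler_wpM2l ?invr_ge0 ?(ltW g0)//.
  by rewrite (le_trans (enormD _ _))// lerD//; [exact: H_bound|exact: BT_bound].
have gi : 0 <= (gamR k)^-1 by rewrite invr_ge0 ltW.
have k1 := ler_wpM2l (mulr_ge0 gi H0) hdx.
have k2 := ler_wpM2l (mulr_ge0 gi B0) hdl.
rewrite /Lambda.
move: (decay t) (enorm l) (Lambda_x k) (cv k) (c1 k) hdx hdl hdu k1 k2 => D n L c c' hdx hdl hdu k1 k2.
lra.
Qed.

End Optimal.

End LQ.

Theorem theorem4 (R : realType) (k : lq_consts R) (hk : consts_pos k) :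
  exists Lam : R, 0 < Lam /\ Lam = Lambda k /\
  forall (nx nu nd : nat) (T : R) (p : lq_data R nx nu nd)
    (PhiA : R -> R -> 'M[R]_nx)
    (S : R -> 'M[R]_nx) (PhiZ : R -> R -> 'M[R]_nx)
    (d : R -> 'cV[R]_nd) (d0 : 'cV[R]_nx) (dT : 'cV[R]_nd)
    (x : R -> 'cV[R]_nx) (u : R -> 'cV[R]_nu) (lam : R -> 'cV[R]_nx)
    (t' : R) (l : 'cV[R]_nd),
  lq_symmetric T p ->
  assumption_A1 T p k ->
  is_evolution T (fA p) PhiA ->
  assumption_A2 T p k PhiA ->
  assumption_A3 T p k ->
  assumption_A4 T p k ->
  riccati_solution T p S ->
  is_evolution T (Zmat p S) PhiZ ->
  bounded_measurable T d ->
  lq_optimal T p d d0 dT x u lam ->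
  0 <= t' <= T ->
  l != 0 ->
  forall t : R, 0 <= t <= T -> t != t' ->
    enorm (x_pert T p S PhiZ d d0 dT t' l t - x t)
    + enorm (u_pert T p S PhiZ d d0 dT t' l t - u t)
    + enorm (lam_pert T p S PhiZ d d0 dT t' l t - lam t)
    <= enorm l * (Lam * expR (- (rhoZ k * `|t - t'|))).
Proof.
exists (Lambda k); split; first exact: Lambda_gt0.
split=> // nx nu nd T p PhiA S PhiZ d d0 dT x u lam t' l.
move=> hsym hA1 hPhiA hA2 hA3 hA4 hS hPhiZ _ hopt /andP[t'0 t'T] _ t tT _.
by apply: (perturbation_bound hk hsym hA1 hA3 hS hPhiZ hPhiA hA2 hA4 hopt l t'0 t'T); rewrite in_itv.
Qed.
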